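(* Let $F\in K[X,Y,Z,U,V]$ be a Perazzo form of degree $d\ge 5$ such that $A_F=R/\operatorname{Ann}_R F$ has the minimal Hilbert function $(1,5,6,6,\ldots,6,5,1)$. Then the two Jordan types $$\bigl(d+1,(d-1)^3,(d-2)^2\bigr)\quad\text{and}\quad \bigl(d^2,(d-1)^2,(d-2)^2\bigr)$$ occur for multiplication by a weak Lefschetz element of $A_F$ (each occurs as $P_{\ell,A_F}$ for some weak Lefschetz element $\ell\in (A_F)_1$). Moreover, for every linear form $\ell\in (A_F)_1$ that is not a weak Lefschetz element, the strings of a Jordan basis for multiplication by $\ell$ on $A_F$ satisfy the following, according to which of the three forms $F$ takes after a linear change of variables: (i) if $F=XU^{d-1}+YU^{d-2}V+ZU^{d-3}V^2$, all strings have length at most $4$; (ii) if $F=XU^{d-1}+YU^{d-2}V+ZV^{d-1}$, every string has length $\ge d-1$ or $\le 3$; (iii) if $F=XU^{d-1}+Y(U+\lambda V)^{d-1}+ZV^{d-1}$ with $\lambda\in K^*$, every string has length $\ge d-1$ or $\le 2$.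
   Context: $K$ is an algebraically closed field of characteristic zero. A Perazzo form of degree $d$ in $K[X,Y,Z,U,V]$ is a homogeneous polynomial of degree $d$ of the form $F = Xp_0+Yp_1+Zp_2+G$ with $p_0,p_1,p_2\in K[U,V]_{d-1}$ linearly independent over $K$ and $G\in K[U,V]_d$. The polynomial ring $R=K[x,y,z,u,v]$ acts on $K[X,Y,Z,U,V]$ by differentiation ($x=\partial/\partial X$, $y=\partial/\partial Y$, $z=\partial/\partial Z$, $u=\partial/\partial U$, $v=\partial/\partial V$); the action is written $p\circ F$. Put $\operatorname{Ann}_R F=\{p\in R \mid p\circ F=0\}$ and $A_F=R/\operatorname{Ann}_R F$, a standard graded Artinian Gorenstein $K$-algebra of socle degree $d$. It is known that every Perazzo form of degree $d\ge 5$ with $A_F$ of Hilbert function $(1,5,6,\ldots,6,5,1)$ can be brought, by a linear change of variables, into one of the three forms listed in (i)-(iii). A linear form $\ell\in A_1$ of a graded Artinian algebra $A$ is a weak Lefschetz element if $\times\ell:A_i\to A_{i+1}$ is injective or surjective for every $i\ge0$. The Jordan type $P_{\ell,A}$ is the partition of $\dim_K A$ given by the sizes of the Jordan blocks of the nilpotent map $\times\ell:A\to A$; exponents denote repeated parts. If $P_{\ell,A}=(p_1,\ldots,p_s)$, a Jordan basis for $\times\ell$ is a $K$-basis of $A$ consisting of strings $(z_i,\ell z_i,\ldots,\ell^{p_i-1}z_i)$, $i=1,\ldots,s$, with $\ell^{p_i}z_i=0$; the length of the $i$-th string is $p_i$. *)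

(* Defs.v *)
From HB Require Import structures.
From mathcomp Require Import all_boot all_order all_algebra.
From mathcomp Require Import bigenough.
From mathcomp Require Import ssrcomplements mpoly.

Set Implicit Arguments.
Unset Strict Implicit.
Unset Printing Implicit Defensive.

Import GRing.Theory BigEnough.
Local Open Scope ring_scope.
Local Open Scope quotient_scope.

(* The ring of differential operators and the ring of forms are both           *)
(* represented by {mpoly K[n]}; diff_act p F is p o F, with 'X_i in p acting   *)
(* as the partial derivative with respect to the i-th variable.                *)
Section DifferentialAction.
Variables (n : nat) (K : comNzRingType).
Implicit Types (p q F : {mpoly K[n]}) (m : 'X_{1..n}).

Definition diff_act p F : {mpoly K[n]} :=
  \sum_(m <- msupp p) p@_m *: F^`M[m].

Lemma diff_actwE k p F : (msize p <= k)%N ->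
  diff_act p F = \sum_(m : 'X_{1..n < k}) p@_m *: F^`M[m].
Proof.
move=> lepk; rewrite /diff_act (big_mksub 'X_{1..n < k}) //=; first last.
- by move=> x /msize_mdeg_lt /leq_trans /(_ lepk) ->.
- exact: msupp_uniq.
by rewrite big_rmcond //= => m /memN_msupp_eq0 ->; rewrite scale0r.
Qed.

Lemma diff_act_linearl F c p q :
  diff_act (c *: p + q) F = c *: diff_act p F + diff_act q F.
Proof.
pose_big_enough k.
  rewrite !(@diff_actwE k) //.
  rewrite scaler_sumr -big_split /=; apply: eq_bigr => m _.
  by rewrite mcoeffD mcoeffZ scalerDl scalerA.
by close.
Qed.

Lemma diff_act_linearr p c F G :
  diff_act p (c *: F + G) = c *: diff_act p F + diff_act p G.
Proof.
rewrite /diff_act scaler_sumr -big_split /=; apply: eq_bigr => m _.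
by rewrite linearP /= scalerDr !scalerA mulrC.
Qed.

Lemma diff_act0r p : diff_act p 0 = 0.
Proof. by rewrite /diff_act big1 // => m _; rewrite linear0 scaler0. Qed.

Lemma diff_act0l F : diff_act 0 F = 0.
Proof. by rewrite /diff_act msupp0 big_nil. Qed.

Lemma diff_actX m F : diff_act 'X_[m] F = F^`M[m].
Proof. by rewrite /diff_act msuppX big_seq1 mcoeffX eqxx scale1r. Qed.

Lemma diff_act1 F : diff_act 1 F = F.
Proof. by rewrite -mpolyX0 diff_actX mderivm0m. Qed.

Lemma diff_actD p q F : diff_act (p + q) F = diff_act p F + diff_act q F.
Proof. by have:= diff_act_linearl F 1 p q; rewrite !scale1r. Qed.

Lemma diff_actZ c p F : diff_act (c *: p) F = c *: diff_act p F.
Proof.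
by have:= diff_act_linearl F c p 0; rewrite !addr0 diff_act0l addr0.
Qed.

Lemma diff_actN p F : diff_act (- p) F = - diff_act p F.
Proof. by rewrite -scaleN1r diff_actZ scaleN1r. Qed.

Lemma diff_actB p q F : diff_act (p - q) F = diff_act p F - diff_act q F.
Proof. by rewrite diff_actD diff_actN. Qed.

Lemma diff_act_suml (I : Type) (r : seq I) (f : I -> {mpoly K[n]}) F :
  diff_act (\sum_(i <- r) f i) F = \sum_(i <- r) diff_act (f i) F.
Proof.
elim: r => [|i r IH]; first by rewrite !big_nil diff_act0l.
by rewrite !big_cons diff_actD IH.
Qed.

Lemma diff_actM p q F : diff_act (p * q) F = diff_act p (diff_act q F).
Proof.
have actXM m : diff_act ('X_[m] * q) F = (diff_act q F)^`M[m].
  rewrite [q in LHS]mpolyE mulr_sumr diff_act_suml [diff_act q F]/diff_act.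
  rewrite linear_sum /=; apply: eq_bigr => m' _.
  rewrite -scalerAr diff_actZ -mpolyXD diff_actX linearZ /=.
  by rewrite addmC mderivmDm.
rewrite [p in LHS]mpolyE mulr_suml diff_act_suml.
by apply: eq_bigr => m _; rewrite -scalerAl diff_actZ actXM.
Qed.

Definition Ann F : {pred {mpoly K[n]}} := fun p => diff_act p F == 0.

Lemma Ann_zmod_closed F : zmod_closed (Ann F).
Proof.
split=> [|p q]; rewrite !unfold_in ?diff_act0l //.
by move=> /eqP hp /eqP hq; rewrite diff_actB hp hq subr0.
Qed.

HB.instance Definition _ F :=
  GRing.isZmodClosed.Build {mpoly K[n]} (Ann F) (Ann_zmod_closed F).

Lemma AnnP F p : reflect (diff_act p F = 0) (p \in Ann F).
Proof. exact: eqP. Qed.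

Lemma Ann_idealr F p q : q \in Ann F -> p * q \in Ann F.
Proof. by move=> /AnnP hq; apply/AnnP; rewrite diff_actM hq diff_act0r. Qed.

Lemma Ann_ideall F p q : q \in Ann F -> q * p \in Ann F.
Proof. by rewrite mulrC; apply: Ann_idealr. Qed.

End DifferentialAction.

(* apolar_alg F is A_F = R / Ann F, as a commutative ring and as a finite      *)
(* dimensional K-vector space.  The ring structure provided by mathcomp for    *)
(* {ideal_quot _} is only available for proper ideals, i.e. for F != 0; the    *)
(* one below is defined for all F.                                             *)
Section ApolarAlgebra.
Variables (n : nat) (K : fieldType) (F : {mpoly K[n]}).
Implicit Types (p q : {mpoly K[n]}).

Definition apolar_alg := {ideal_quot Ann F}.

HB.instance Definition _ := GRing.Zmodule.on apolar_alg.
HB.instance Definition _ := EqQuotient.on apolar_alg.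

Definition apolar_pi p : apolar_alg := \pi_apolar_alg p.

Lemma apolar_piP p q : apolar_pi p = apolar_pi q <-> p - q \in Ann F.
Proof.
rewrite /apolar_pi (Quotient.idealrBE (Ann F : zmodClosed {mpoly K[n]}) p q).
by split=> [/eqP|/eqP].
Qed.

Lemma apolar_reprK a : apolar_pi (repr a) = a.
Proof. exact: reprK. Qed.

Lemma apolar_repr p : exists2 r, r \in Ann F & repr (apolar_pi p) = p + r.
Proof.
exists (repr (apolar_pi p) - p); last by rewrite addrC subrK.
by apply/apolar_piP; rewrite apolar_reprK.
Qed.

Lemma apolar_piB : {morph apolar_pi : p q / p - q}.
Proof.
move=> p q; rewrite /apolar_pi.
exact: (raddfB (\pi_(Quotient.quot (Ann F : zmodClosed {mpoly K[n]})))).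
Qed.

Lemma apolar_piD : {morph apolar_pi : p q / p + q}.
Proof.
move=> p q; rewrite /apolar_pi.
exact: (raddfD (\pi_(Quotient.quot (Ann F : zmodClosed {mpoly K[n]})))).
Qed.

Definition apolar_one : apolar_alg := apolar_pi 1.
Definition apolar_mul (a b : apolar_alg) : apolar_alg :=
  apolar_pi (repr a * repr b).
Definition apolar_scale (c : K) (a : apolar_alg) : apolar_alg :=
  apolar_pi (c *: repr a).

Lemma apolar_mulE p q :
  apolar_mul (apolar_pi p) (apolar_pi q) = apolar_pi (p * q).
Proof.
rewrite /apolar_mul; have [r hr ->] := apolar_repr p.
have [s hs ->] := apolar_repr q; apply/apolar_piP.
have -> : (p + r) * (q + s) - p * q = p * s + r * (q + s).
  by rewrite mulrDl [p * (q + s)]mulrDr -[p * q + _ + _]addrA [p * q + _]addrC addrK.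
by apply: rpredD; [apply: Ann_idealr | apply: Ann_ideall].
Qed.

Lemma Ann_scale c p : p \in Ann F -> c *: p \in Ann F.
Proof. by move=> /AnnP hp; apply/AnnP; rewrite diff_actZ hp scaler0. Qed.

Lemma apolar_scaleE c p : apolar_scale c (apolar_pi p) = apolar_pi (c *: p).
Proof.
rewrite /apolar_scale; have [r hr ->] := apolar_repr p; apply/apolar_piP.
by rewrite scalerDr addrAC subrr add0r Ann_scale.
Qed.

Lemma apolar_mulA : associative apolar_mul.
Proof.
move=> a b c; rewrite -[a]apolar_reprK -[b]apolar_reprK -[c]apolar_reprK.
by rewrite !apolar_mulE mulrA.
Qed.

Lemma apolar_mulC : commutative apolar_mul.
Proof.
move=> a b; rewrite -[a]apolar_reprK -[b]apolar_reprK.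
by rewrite !apolar_mulE mulrC.
Qed.

Lemma apolar_mul1 : left_id apolar_one apolar_mul.
Proof. by move=> a; rewrite -[a]apolar_reprK apolar_mulE mul1r. Qed.

Lemma apolar_mulDl : left_distributive apolar_mul +%R.
Proof.
move=> a b c; rewrite -[a]apolar_reprK -[b]apolar_reprK -[c]apolar_reprK.
by rewrite -apolar_piD !apolar_mulE mulrDl apolar_piD.
Qed.

HB.instance Definition _ := GRing.Zmodule_isComPzRing.Build apolar_alg
  apolar_mulA apolar_mulC apolar_mul1 apolar_mulDl.

Lemma apolar_scaleA c d a :
  apolar_scale c (apolar_scale d a) = apolar_scale (c * d) a.
Proof. by rewrite -[a]apolar_reprK !apolar_scaleE scalerA. Qed.

Lemma apolar_scale1 : left_id 1 apolar_scale.
Proof. by move=> a; rewrite -[a]apolar_reprK apolar_scaleE scale1r. Qed.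

Lemma apolar_scaleDr : right_distributive apolar_scale +%R.
Proof.
move=> c a b; rewrite -[a]apolar_reprK -[b]apolar_reprK.
by rewrite -apolar_piD !apolar_scaleE scalerDr apolar_piD.
Qed.

Lemma apolar_scaleDl a : {morph apolar_scale^~ a : c d / c + d}.
Proof.
move=> c d; rewrite -[a]apolar_reprK.
by rewrite !apolar_scaleE scalerDl apolar_piD.
Qed.

HB.instance Definition _ := GRing.Zmodule_isLmodule.Build K apolar_alg
  apolar_scaleA apolar_scale1 apolar_scaleDr apolar_scaleDl.

Lemma apolar_piM : {morph apolar_pi : p q / p * q}.
Proof. by move=> p q; rewrite -apolar_mulE. Qed.

Lemma apolar_pi1 : apolar_pi 1 = 1.
Proof. by []. Qed.

Lemma apolar_piZ c p : apolar_pi (c *: p) = c *: apolar_pi p.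
Proof. by rewrite -apolar_scaleE. Qed.

Lemma apolar_scalerAl c (a b : apolar_alg) : c *: (a * b) = (c *: a) * b.
Proof.
rewrite -[a]apolar_reprK -[b]apolar_reprK.
by rewrite -apolar_piM -!apolar_piZ -apolar_piM scalerAl.
Qed.

Lemma apolar_scalerAr c (a b : apolar_alg) : c *: (a * b) = a * (c *: b).
Proof. by rewrite mulrC apolar_scalerAl mulrC. Qed.

Lemma apolar_pi_is_linear : linear apolar_pi.
Proof. by move=> c p q; rewrite apolar_piD apolar_piZ. Qed.

HB.instance Definition _ :=
  GRing.isLinear.Build K {mpoly K[n]} apolar_alg _ apolar_pi
    apolar_pi_is_linear.

Lemma apolar_pi_eq0 p : apolar_pi p = 0 <-> diff_act p F = 0.
Proof.
rewrite -(linear0 apolar_pi); split=> [/apolar_piP|h].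
  by rewrite subr0 => /AnnP.
by apply/apolar_piP; rewrite subr0; apply/AnnP.
Qed.

(* Finite dimensionality: a |-> repr a o F embeds A_F in the space of          *)
(* polynomials of size <= msize F, and A_F is spanned by monomials.            *)
Local Notation N := #|{: 'X_{1..n < msize F}}|.

Definition apolar_mon (i : 'I_N) : 'X_{1..n} :=
  (enum_val i : 'X_{1..n < msize F}).

Definition apolar_coord (a : apolar_alg) : 'rV[K]_N :=
  \row_(i < N) (diff_act (repr a) F)@_(apolar_mon i).

Lemma diff_act_repr p : diff_act (repr (apolar_pi p)) F = diff_act p F.
Proof.
have [r /AnnP hr ->] := apolar_repr p.
by rewrite diff_actD hr addr0.
Qed.

Lemma mcoeff_diff_act_ge p m : (msize F <= mdeg m)%N ->
  (diff_act p F)@_m = 0.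
Proof.
move=> lem; rewrite /diff_act linear_sum big1 //= => m' _.
rewrite mcoeffZ mcoeff_mderivm (@memN_msupp_eq0 _ _ F) ?mul0rn ?mulr0 //.
apply/negP => /msize_mdeg_lt; rewrite ltnNge => /negP; apply.
by rewrite mdegD (leq_trans lem) // leq_addl.
Qed.

Lemma apolar_coord_is_linear : linear apolar_coord.
Proof.
move=> c a b; apply/rowP => i; rewrite !mxE.
rewrite -[a]apolar_reprK -[b]apolar_reprK -linearP !diff_act_repr.
by rewrite diff_act_linearl mcoeffD mcoeffZ.
Qed.

HB.instance Definition _ :=
  GRing.isLinear.Build K apolar_alg 'rV[K]_N _ apolar_coord
    apolar_coord_is_linear.

Lemma apolar_coord_inj : injective apolar_coord.
Proof.
suff coord0 a : apolar_coord a = 0 -> a = 0.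
  move=> a b eq_ab; apply/eqP; rewrite -subr_eq0; apply/eqP/coord0.
  by rewrite linearB /= eq_ab subrr.
move=> /rowP ha; rewrite -[a]apolar_reprK; apply/apolar_pi_eq0/mpolyP => m.
rewrite mcoeff0; have [lem|ltm] := leqP (msize F) (mdeg m).
  exact: mcoeff_diff_act_ge.
by have:= ha (enum_rank (BMultinom ltm)); rewrite !mxE /apolar_mon enum_rankK.
Qed.

Definition apolar_gen (i : 'I_N) : apolar_alg :=
  apolar_pi 'X_[apolar_mon i].

Definition apolar_gen_mx : 'M[K]_N := \matrix_i apolar_coord (apolar_gen i).

Lemma apolar_coord_comb (w : 'rV[K]_N) :
  apolar_coord (\sum_i w 0 i *: apolar_gen i) = w *m apolar_gen_mx.
Proof.
rewrite linear_sum /= mulmx_sum_row; apply: eq_bigr => i _.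
by rewrite linearZ /= rowK.
Qed.

Lemma apolar_genP a : exists w : 'rV[K]_N, a = \sum_i w 0 i *: apolar_gen i.
Proof.
rewrite -[a]apolar_reprK; set p := repr a.
exists (\row_(i < N) p@_(apolar_mon i)).
rewrite [p in LHS]mpolyE linear_sum /=.
pose f (m : 'X_{1..n}) := p@_m *: apolar_pi 'X_[m].
rewrite (eq_bigr f); last by move=> m _; rewrite linearZ.
rewrite [RHS](eq_bigr (fun i : 'I_N => f (apolar_mon i)));
  last by move=> i _; rewrite mxE.
rewrite -(big_enum_val (A := {: 'X_{1..n < msize F}}) (fun m => f (bmnm m))) /=.
have f0 m : (msize F <= mdeg m)%N -> f m = 0.
  move=> lem; rewrite /f; suff -> : apolar_pi 'X_[m] = 0 by rewrite scaler0.
  apply/apolar_pi_eq0; rewrite diff_actX; apply/mpolyP => m'.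
  rewrite mcoeff_mderivm mcoeff0 (@memN_msupp_eq0 _ _ F) ?mul0rn //.
  apply/negP => /msize_mdeg_lt; rewrite ltnNge => /negP; apply.
  by rewrite mdegD (leq_trans lem) // leq_addr.
rewrite (bigID (fun m : 'X_{1..n} => (mdeg m < msize F)%N)) /=.
rewrite [X in _ + X]big1 ?addr0; last by move=> m; rewrite -leqNgt => /f0.
rewrite (big_mksub_cond 'X_{1..n < msize F}) //=; last exact: msupp_uniq.
rewrite big_rmcond_in //= => m _; rewrite negb_and.
by rewrite bmdeg /= => /memN_msupp_eq0; rewrite /f => ->; rewrite scale0r.
Qed.

Lemma apolar_coord_sub a : (apolar_coord a <= apolar_gen_mx)%MS.
Proof.
by have [w ->] := apolar_genP a; rewrite apolar_coord_comb submxMl.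
Qed.

Local Notation B := (row_base apolar_gen_mx).

Definition apolar_v2r (a : apolar_alg) : 'rV[K]_(\rank apolar_gen_mx) :=
  apolar_coord a *m pinvmx B.

Definition apolar_r2v (w : 'rV[K]_(\rank apolar_gen_mx)) : apolar_alg :=
  \sum_i (w *m B *m pinvmx apolar_gen_mx) 0 i *: apolar_gen i.

Lemma apolar_coord_r2v w : apolar_coord (apolar_r2v w) = w *m B.
Proof.
rewrite apolar_coord_comb mulmxKpV //.
by rewrite (submx_trans (submxMl _ _)) // eq_row_base.
Qed.

Lemma apolar_v2r_linear : linear apolar_v2r.
Proof.
by move=> c a b; rewrite /apolar_v2r linearP mulmxDl scalemxAl.
Qed.

Lemma apolar_v2r_bij : bijective apolar_v2r.
Proof.
exists apolar_r2v => [a|w].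
  apply: apolar_coord_inj; rewrite apolar_coord_r2v mulmxKpV //.
  by rewrite eq_row_base apolar_coord_sub.
by rewrite /apolar_v2r apolar_coord_r2v mulmxKp // row_base_free.
Qed.

Lemma apolar_vector_axiom : Vector.axiom (\rank apolar_gen_mx) apolar_alg.
Proof. by exists apolar_v2r; [apply: apolar_v2r_linear | apply: apolar_v2r_bij]. Qed.

HB.instance Definition _ :=
  Lmodule_hasFinDim.Build K apolar_alg apolar_vector_axiom.

End ApolarAlgebra.

Section Grading.
Variables (n : nat) (K : fieldType) (F : {mpoly K[n.+1]}).

(* (A_F)_i, the image of R_i in A_F *)
Definition apolar_comp (i : nat) : {vspace apolar_alg F} :=
  limg (linfun (apolar_pi F \o @mpoly_of_dhomog n.+1 K i)).

Lemma apolar_compP i (a : apolar_alg F) :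
  reflect (exists2 p, p \is i.-homog & a = apolar_pi F p)
          (a \in apolar_comp i).
Proof.
apply: (iffP memv_imgP) => [[p _ ->]|[p hp ->]].
  by exists (mpoly_of_dhomog p); [apply: dhomog_is_dhomog | rewrite lfunE].
by exists (DHomog hp); rewrite ?memvf // lfunE.
Qed.

Definition hilbert (i : nat) : nat := \dim (apolar_comp i).

Definition weak_lefschetz (l : apolar_alg F) : Prop :=
  l \in apolar_comp 1 /\
  forall i : nat,
    {in apolar_comp i &, injective ( *%R l)} \/
    {in apolar_comp i.+1,
      forall b, exists2 a, a \in apolar_comp i & l * a = b}.

End Grading.

Section JordanType.
Variables (K : fieldType) (V : vectType K) (f : V -> V).

(* A Jordan basis is given by the list of pairs (z, p), one for each string    *)
(* z, f z, ..., f^(p-1) z, where p > 0 is the length of the string.            *)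
Definition jordan_basis (zs : seq (V * nat)) : Prop :=
  [/\ {in zs, forall z, 0 < z.2}%N,
      {in zs, forall z, iter z.2 f z.1 = 0} &
      basis_of fullv (flatten [seq traject f z.1 z.2 | z <- zs])].

Definition string_lengths (zs : seq (V * nat)) : seq nat := unzip2 zs.

Definition jordan_type (ps : seq nat) : Prop :=
  sorted geq ps /\
  exists2 zs : seq (V * nat), jordan_basis zs & string_lengths zs = ps.

End JordanType.

Section PerazzoForms.
Variable K : fieldType.

(* The variables X, Y, Z, U, V are those of index 0, 1, 2, 3, 4. *)
Definition pX : {mpoly K[5]} := 'X_(@Ordinal 5 0 isT).
Definition pY : {mpoly K[5]} := 'X_(@Ordinal 5 1 isT).
Definition pZ : {mpoly K[5]} := 'X_(@Ordinal 5 2 isT).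
Definition pU : {mpoly K[5]} := 'X_(@Ordinal 5 3 isT).
Definition pV : {mpoly K[5]} := 'X_(@Ordinal 5 4 isT).

(* the inclusion of K[U,V] in K[X,Y,Z,U,V] *)
Definition incUV (p : {mpoly K[2]}) : {mpoly K[5]} := p \mPo [tuple pU; pV].

Definition perazzo_form (d : nat) (F : {mpoly K[5]}) : Prop :=
  exists (p0 p1 p2 : dhomog 2 K d.-1) (G : dhomog 2 K d),
    free [:: p0; p1; p2] /\
    F = pX * incUV p0 + pY * incUV p1 + pZ * incUV p2 + incUV G.

Definition lin_subst (M : 'M[K]_5) (F : {mpoly K[5]}) : {mpoly K[5]} :=
  F \mPo [tuple \sum_(j < 5) M i j *: 'X_j | i < 5].

Definition lin_equiv (F F' : {mpoly K[5]}) : Prop :=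
  exists2 M : 'M[K]_5, M \in unitmx & lin_subst M F = F'.

Definition form_i (d : nat) : {mpoly K[5]} :=
  pX * pU ^+ (d - 1) + pY * pU ^+ (d - 2) * pV
  + pZ * pU ^+ (d - 3) * pV ^+ 2.

Definition form_ii (d : nat) : {mpoly K[5]} :=
  pX * pU ^+ (d - 1) + pY * pU ^+ (d - 2) * pV + pZ * pV ^+ (d - 1).

Definition form_iii (d : nat) (lam : K) : {mpoly K[5]} :=
  pX * pU ^+ (d - 1) + pY * (pU + lam *: pV) ^+ (d - 1)
  + pZ * pV ^+ (d - 1).

End PerazzoForms.

(* (1, 5, 6, ..., 6, 5, 1), of length d + 1 *)
Definition min_hilbert_seq (d : nat) : seq nat :=
  ([:: 1; 5] ++ nseq (d - 3) 6 ++ [:: 5; 1])%N.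

(* Main.v *)
(** Write A = A_F with linear generators x, y, z, u, v, let N = <x, y, z>, so
    that N^2 = 0, and let I be the ideal of the forms of K[u, v] that kill N.
    The Hilbert function and the duality of A force K[u, v] / I to have
    dimension 3 in the degrees 2, ..., d - 1 and the annihilator of N in A_i to
    be N A_{i-1}; in particular I contains a cubic q.  If l' is a linear form
    in u, v which does not divide q and m is in N, then l' + m is a weak
    Lefschetz element: modulo q, every form of degree k >= 3 in u, v is a
    multiple of l', so that l' is bijective on K[u, v] / I in the degrees
    2, ..., d - 1, and the rest follows by duality.  Since N A_{d-2} has
    dimension 2, l^(d-2) kills a nonzero element of N, so that the Jordan type
    of l is the first one if l^d <> 0, and the second one if l^d = 0 and
    l^(d-1) <> 0; both occur because l^d = l'^d + d m l'^(d-1), where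
    m l'^(d-1) can be any element of A_d.  No normal form of F is
    needed for this part.

    For the normal forms, a linear form l which is not weak Lefschetz is thus
    l' + m with l' a factor of q (or 0).  In case (i) this gives l^4 = 0.  In
    the other cases one shows that l^(d-2) a = 0 implies that l^k a is in
    l^(k+1) A, with k = 3 if l' is the double factor of q and k = 2 otherwise;
    then no vector can start a string of a length strictly between k and
    d - 1. *)

Require Import Defs.
From HB Require Import structures.
From mathcomp Require Import all_boot all_order all_algebra.
From mathcomp Require Import mpoly.
From mathcomp Require Import ring zify.

Set Implicit Arguments.
Unset Strict Implicit.
Unset Printing Implicit Defensive.

Import GRing.Theory.
Local Open Scope ring_scope.

(** * Linear substitutions and derivatives *)

Section CompDeriv.
Variables (K : comNzRingType).

(** Induction along the ring generators: identities about substitution and differentiation then need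
    checking only on constants and variables. *)
Lemma mpoly_rect_ring n (P : {mpoly K[n]} -> Prop) :
  (forall c, P c%:MP) -> (forall i, P 'X_i) ->
  (forall p q, P p -> P q -> P (p + q)) ->
  (forall p q, P p -> P q -> P (p * q)) -> forall p, P p.
Proof.
move=> PC PX PD PM; have PXm m : P 'X_[m].
  rewrite mpolyXE_id; apply: big_ind => //; first by rewrite -mpolyC1.
  move=> i _; elim: (m i) => [|k IH]; first by rewrite expr0 -mpolyC1.
  by rewrite exprS; apply: PM.
elim/mpolyind => [|c m p _ _ Pp]; first by rewrite -mpolyC0.
by apply: PD => //; rewrite -mul_mpolyC; apply: PM.
Qed.

Lemma mderivXU n (i j : 'I_n) : ('X_i : {mpoly K[n]})^`M(j) = (i == j)%:R.
Proof.
rewrite mderivX mnm1E; have [->|_] := eqVneq i j; last by rewrite scale0r.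
rewrite scale1r (_ : (U_(j) - U_(j))%MM = 0%MM) ?mpolyX0 //.
by apply/mnmP => k; rewrite mnmBE mnm0E subnn.
Qed.

(** The chain rule for polynomial substitution. *)
Lemma mderiv_comp n k (t : n.-tuple {mpoly K[k]}) j (p : {mpoly K[n]}) :
  (p \mPo t)^`M(j) = \sum_(i < n) (p^`M(i) \mPo t) * (tnth t i)^`M(j).
Proof.
elim/mpoly_rect_ring: p => [c|i|p q IHp IHq|p q IHp IHq].
- rewrite comp_mpolyC mderivC big1 // => i _.
  by rewrite mderivC comp_mpoly0 mul0r.
- rewrite comp_mpolyXU (bigD1 i) //= big1 ?addr0 => [|i' ne_i'].
    by rewrite mderivXU eqxx comp_mpoly1 mul1r (tnth_nth 0).
  by rewrite mderivXU eq_sym (negPf ne_i') comp_mpoly0 mul0r.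
- rewrite comp_mpolyD mderivD IHp IHq -big_split; apply: eq_bigr => i _ /=.
  by rewrite mderivD comp_mpolyD mulrDl.
- rewrite rmorphM mderivM IHp IHq mulr_suml mulr_sumr -big_split.
  apply: eq_bigr => i _ /=; rewrite mderivM comp_mpolyD !rmorphM /=.
  by rewrite mulrDl mulrAC mulrA.
Qed.

Lemma comp_mpolyA n k m (s : n.-tuple {mpoly K[k]}) (t : k.-tuple {mpoly K[m]})
    (p : {mpoly K[n]}) :
  (p \mPo s) \mPo t = p \mPo [tuple tnth s i \mPo t | i < n].
Proof.
elim/mpoly_rect_ring: p => [c|i|p q IHp IHq|p q IHp IHq].
- by rewrite !comp_mpolyC.
- by rewrite !comp_mpolyXU -!tnth_nth tnth_mktuple.
- by rewrite !comp_mpolyD IHp IHq.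
- by rewrite !rmorphM /= IHp IHq.
Qed.

Lemma comp_mpoly_homog n k (t : n.-tuple {mpoly K[k]}) e (p : {mpoly K[n]}) :
  (forall i, tnth t i \is 1.-homog) -> p \is e.-homog -> p \mPo t \is e.-homog.
Proof.
move=> ht /dhomogP hp; rewrite comp_mpolyEX big_seq.
apply: rpred_sum => m /hp /= <-; apply: rpredZ.
rewrite comp_mpolyX mdegE.
elim/big_rec2: _ => [|i e' q _ hq]; first exact: dhomog1.
by apply: dhomogM => //; have:= dhomogMn (m i) (ht i); rewrite mul1n.
Qed.

Lemma diff_actXU n (i : 'I_n) (F : {mpoly K[n]}) : diff_act 'X_i F = F^`M(i).
Proof. by rewrite diff_actX mderivmU1m. Qed.

Lemma diff_actC n c (F : {mpoly K[n]}) : diff_act c%:MP F = c *: F.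
Proof. by rewrite -[c%:MP]mulr1 mul_mpolyC diff_actZ diff_act1. Qed.

End CompDeriv.

Section LinSubst.
Variables (K : fieldType).
Implicit Types (M N : 'M[K]_5) (p F : {mpoly K[5]}).

Lemma linform_homog (c : 'I_5 -> K) :
  \sum_(j < 5) c j *: ('X_j : {mpoly K[5]}) \is 1.-homog.
Proof. by apply: rpred_sum => j _; apply: rpredZ; rewrite dhomogX /= mdeg1. Qed.

Lemma lin_subst_homog M e p : p \is e.-homog -> lin_subst M p \is e.-homog.
Proof.
by apply: comp_mpoly_homog => i; rewrite tnth_mktuple; apply: linform_homog.
Qed.

Lemma lin_substX M i : lin_subst M 'X_i = \sum_(j < 5) M i j *: 'X_j.
Proof. by rewrite /lin_subst comp_mpolyXU -tnth_nth tnth_mktuple. Qed.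

Lemma lin_substM M N p : lin_subst M (lin_subst N p) = lin_subst (N *m M) p.
Proof.
rewrite /lin_subst comp_mpolyA; congr (p \mPo _); apply: eq_from_tnth => i.
rewrite !tnth_mktuple linear_sum /=.
under eq_bigr do rewrite linearZ /= -/(lin_subst M _) lin_substX scaler_sumr.
rewrite exchange_big; apply: eq_bigr => k _; rewrite mxE scaler_suml.
by apply: eq_bigr => j _; rewrite scalerA.
Qed.

Lemma lin_subst1 p : lin_subst 1%:M p = p.
Proof.
rewrite -[RHS]comp_mpoly_id /lin_subst; congr (p \mPo _).
apply: eq_from_tnth => i; rewrite !tnth_mktuple (bigD1 i) //= big1 => [|j ne_j].
  by rewrite mxE eqxx scale1r addr0.
by rewrite mxE eq_sym (negPf ne_j) scale0r.
Qed.

Lemma lin_substK M p : M \in unitmx -> lin_subst (invmx M) (lin_subst M p) = p.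
Proof. by move=> uM; rewrite lin_substM mulmxV // lin_subst1. Qed.

Lemma lin_substKV M p : M \in unitmx -> lin_subst M (lin_subst (invmx M) p) = p.
Proof. by move=> uM; rewrite lin_substM mulVmx // lin_subst1. Qed.

(** By the chain rule, operators transform by the transpose of [M]. The induction on [p] keeps [F]
    general, because a product of operators acts in two stages. *)
Lemma diff_act_lin_subst M p F :
  diff_act p (lin_subst M F) = lin_subst M (diff_act (lin_subst M^T p) F).
Proof.
elim/mpoly_rect_ring: p F => [c|i|p q IHp IHq|p q IHp IHq] F.
- by rewrite /lin_subst comp_mpolyC !diff_actC comp_mpolyZ.
- rewrite diff_actXU lin_substX diff_act_suml.
  rewrite /lin_subst mderiv_comp linear_sum; apply: eq_bigr => j _ /=.
  rewrite diff_actZ diff_actXU linearZ /= tnth_mktuple mxE.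
  rewrite -mul_mpolyC mulrC; congr (_ * _).
  rewrite linear_sum (bigD1 i) //= big1 => [|k ne_k].
    by rewrite mderivZ mderivXU eqxx addr0 -mul_mpolyC mulr1.
  by rewrite mderivZ mderivXU (negPf ne_k) scaler0.
- rewrite diff_actD IHp IHq /lin_subst -comp_mpolyD -diff_actD.
  by rewrite -comp_mpolyD.
- rewrite diff_actM IHq IHp -diff_actM.
  by congr (lin_subst _ (diff_act _ _)); rewrite /lin_subst rmorphM.
Qed.

End LinSubst.

(** * Grading and duality *)

Section ApolarGrading.
Variables (n d : nat) (K : fieldType) (F : {mpoly K[n.+1]}).
Hypotheses (charK : [pchar K] =i pred0) (homF : F \is d.-homog).
Local Notation A := (apolar_alg F).
Local Notation Ac := (apolar_comp F).
Implicit Types (a b l : A) (p : {mpoly K[n.+1]}).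

Definition apolar_mull a b : A := a * b.

Fact apolar_mull_linear a : linear (apolar_mull a).
Proof. by move=> c b b'; rewrite /apolar_mull mulrDr apolar_scalerAr. Qed.

HB.instance Definition _ a :=
  GRing.isLinear.Build K A A _ (apolar_mull a) (apolar_mull_linear a).

Definition amul a : 'End(A) := linfun (apolar_mull a).

Lemma amulE a b : amul a b = a * b. Proof. by rewrite lfunE. Qed.

(* F is a degree d form, so this is the duality functional A_d -> K,
   extended by 0 to the other degrees. *)
Definition socle_form a : K^o := (diff_act (repr a) F)@_0%MM.

Lemma socle_form_pi p : socle_form (apolar_pi F p) = (diff_act p F)@_0%MM.
Proof. by rewrite /socle_form diff_act_repr. Qed.

Fact socle_form_linear : linear socle_form.
Proof.
move=> c a b; rewrite -[a]apolar_reprK -[b]apolar_reprK -linearP !socle_form_pi.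
by rewrite diff_act_linearl mcoeffD mcoeffZ.
Qed.

HB.instance Definition _ :=
  GRing.isLinear.Build K A K^o _ socle_form socle_form_linear.

Local Notation sigma := socle_form.

(** An operator of degree [i] lowers degrees by exactly [i], so only monomials of degree [d - i] can
    survive in its value at [F]. *)
Lemma diff_act_coeff0 i p m : p \is i.-homog -> (i + mdeg m)%N != d ->
  (diff_act p F)@_m = 0.
Proof.
move=> /dhomogP hp ne; rewrite /diff_act linear_sum big_seq big1 //= => m' m'p.
rewrite mcoeffZ mcoeff_mderivm (dhomog_nemf_coeff homF) ?mul0rn ?mulr0 //.
by rewrite /= mdegD hp.
Qed.

Lemma socle_form_comp i a : a \in Ac i -> i != d -> sigma a = 0.
Proof.
move=> /apolar_compP[p hp ->] ne; rewrite socle_form_pi.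
by rewrite (diff_act_coeff0 hp) // mdeg0 addn0.
Qed.

Lemma comp_gt i a : (d < i)%N -> a \in Ac i -> a = 0.
Proof.
move=> ltdi /apolar_compP[p hp ->]; apply/apolar_pi_eq0/mpolyP => m.
by rewrite mcoeff0 (diff_act_coeff0 hp) // gtn_eqF // ltn_addr.
Qed.

Lemma comp_pi i p : p \is i.-homog -> apolar_pi F p \in Ac i.
Proof. by move=> hp; apply/apolar_compP; exists p. Qed.

Lemma comp_mul i j a b : a \in Ac i -> b \in Ac j -> a * b \in Ac (i + j)%N.
Proof.
move=> /apolar_compP[p hp ->] /apolar_compP[q hq ->].
by rewrite -apolar_piM comp_pi // dhomogM.
Qed.

Lemma comp_mul1 i a b : a \in Ac 1 -> b \in Ac i -> a * b \in Ac i.+1.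
Proof. exact: (@comp_mul 1). Qed.

Lemma comp_1 : 1 \in Ac 0.
Proof. by rewrite -apolar_pi1 comp_pi // dhomog1. Qed.

Lemma comp_exp i l : l \in Ac 1 -> l ^+ i \in Ac i.
Proof.
move=> hl; elim: i => [|i IH]; first by rewrite expr0 comp_1.
by rewrite exprS comp_mul1.
Qed.

Lemma comp0_scalar a : a \in Ac 0 -> exists c : K, a = c *: (1 : A).
Proof.
move=> /apolar_compP[p hp ->]; exists p@_0.
rewrite -apolar_pi1 -apolar_piZ; congr apolar_pi; apply/mpolyP => m.
rewrite mcoeffZ -mpolyX0 mcoeffX eq_sym; have [->|nz] := eqVneq m 0%MM.
  by rewrite mulr1.
by rewrite mulr0 (dhomog_nemf_coeff hp) //= mdeg_eq0.
Qed.

(** This is the standard grading of A_F: a monomial of positive degree has a variable as a factor,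
    and what remains has degree one less. *)
Lemma compS_sub i (W : {vspace A}) :
  (forall a b, a \in Ac 1 -> b \in Ac i -> a * b \in W) -> (Ac i.+1 <= W)%VS.
Proof.
move=> hW; apply/subvP => _ /apolar_compP[p /dhomogP hp ->].
rewrite [p]mpolyE big_seq linear_sum rpred_sum //= => m /hp /= mE.
rewrite linearZ rpredZ //=; have /existsP[k mk] : [exists k, (0 < m k)%N].
  apply: contraPT mE => /existsPn m0.
  suff -> : m = 0%MM by rewrite mdeg0.
  by apply/mnmP => k; rewrite mnm0E; apply/eqP; rewrite -leqn0 leqNgt m0.
have le1 : (U_(k) <= m)%MM.
  by apply/mnm_lepP => j; rewrite mnm1E; case: eqP => [<-|].
rewrite -(submK le1) addmC mpolyXD apolar_piM hW // comp_pi // dhomogX //=.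
  by rewrite mdeg1.
by have := congr1 mdeg (submK le1); rewrite mdegD mdeg1 mE addn1 => -[->].
Qed.

(** Gorenstein duality between A_i and A_{d-i}: the coefficient of [m] in p o F is, up to a nonzero
    integer, the value of [socle_form] at the class of [p] times the monomial [m]. *)
Lemma socle_form_nondeg i a : a \in Ac i -> (i <= d)%N ->
  (forall b, b \in Ac (d - i) -> sigma (a * b) = 0) -> a = 0.
Proof.
move=> /apolar_compP[p hp ->] lei h; apply/apolar_pi_eq0/mpolyP => m.
rewrite mcoeff0; have [eqd|] := eqVneq (i + mdeg m)%N d; last first.
  exact: diff_act_coeff0.
have := h (apolar_pi F 'X_[m]); rewrite comp_pi => [/(_ isT)|]; last first.
  by rewrite dhomogX /= -eqd addKn.
rewrite -apolar_piM socle_form_pi mulrC diff_actM diff_actX mcoeff_mderivm addm0.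
(* The integer factor is the product of the factorials produced by differentiating along [m]; it
   survives in characteristic zero. *)
move/eqP; rewrite -mulr_natr mulf_eq0 => /orP[/eqP-> //|].
rewrite ((pcharf0P K).1 charK) gtn_eqF // prodn_gt0 // => k.
by rewrite ffact_gt0.
Qed.

Lemma comp_le_d i : (d < i)%N -> Ac i = 0%VS.
Proof.
move=> lti; apply/eqP; rewrite -subv0; apply/subvP => a /(comp_gt lti) ->.
exact: mem0v.
Qed.

Lemma comp_sum_full : (\sum_(i < d.+1) Ac i)%VS = fullv.
Proof.
apply/eqP; rewrite eqEsubv subvf; apply/subvP => a _.
rewrite -[a]apolar_reprK [repr a](pihomog_partitionE (leqnn (msize _))).
rewrite linear_sum rpred_sum //= => i _.
have hi := comp_pi (pihomogP mdeg i (repr a)).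
have [lei|/comp_gt/(_ hi) ->] := leqP i d; last exact: mem0v.
by apply: subvP hi; apply: (sumv_sup (inord i)); rewrite ?inordK.
Qed.

(** Multiplying a relation by an element of A_{d-i} and applying [sigma] isolates its term of degree
    [i], since [sigma] vanishes outside degree [d]; nondegeneracy then kills that term. *)
Lemma comp_direct : directv (\sum_(i < d.+1) Ac i).
Proof.
apply/directv_sum_independent => /= a ha suma i _.
apply: (socle_form_nondeg (ha i isT)) => [|b hb]; first by rewrite -ltnS.
have := congr1 sigma (congr1 ( *%R^~ b) suma).
rewrite mul0r linear0 mulr_suml linear_sum (bigD1 i) //= big1 ?addr0 // => j ne.
apply: (socle_form_comp (comp_mul (ha j isT) hb)).
apply: contra ne => /eqP h; apply/eqP/val_inj => /=.
by have := ltn_ord i; rewrite ltnS; lia.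
Qed.

Lemma dim_apolar : \dim {:A} = (\sum_(i < d.+1) hilbert F i)%N.
Proof. by rewrite -comp_sum_full (directvP comp_direct). Qed.

(** The quotient of [U] by the vectors orthogonal to [V] embeds in the dual of [V], and [f] on [U]
    factors through that quotient. All dimension bounds by duality below have this form. *)
Lemma pair_dim (B : vectType K) (U V : {vspace A}) (f : 'Hom(A, B)) :
  (forall a, a \in U -> (forall b, b \in V -> sigma (a * b) = 0) -> f a = 0) ->
  (\dim (f @: U) <= \dim V)%N.
Proof.
move=> h; pose g a : 'rV[K]_(\dim V) := \row_i sigma (a * (vbasis V)`_i).
have g_lin : linear g.
  by move=> c a b; apply/rowP => i; rewrite !mxE mulrDl -apolar_scalerAl linearP.
pose gL := GRing.isLinear.Build _ _ _ _ g g_lin.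
pose G : {linear A -> 'rV[K]_(\dim V)} := HB.pack g gL.
have gE a : linfun G a = g a by rewrite lfunE.
have le1 : (\dim (U :&: lker (linfun G)) <= \dim (U :&: lker f))%N.
  apply/dimvS/subvP => a; rewrite !memv_cap !memv_ker gE => /andP[aU /eqP ga].
  rewrite aU; apply/eqP/h => // b /coord_vbasis ->.
  rewrite mulr_sumr linear_sum big1 // => i _.
  rewrite -apolar_scalerAr linearZ /=.
  by have /rowP/(_ i) := ga; rewrite !mxE => ->; rewrite scaler0.
have le2 : (\dim (linfun G @: U) <= \dim V)%N.
  by rewrite (leq_trans (dimvS (subvf _))) // dimvf dim_matrix mul1r.
rewrite -(leq_add2l (\dim (U :&: lker f))) limg_ker_dim.
by rewrite -(limg_ker_dim (linfun G) U) leq_add.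
Qed.

End ApolarGrading.

(** * Jordan strings *)

Section JordanStrings.
Variables (K : fieldType) (V : vectType K) (f : V -> V) (g : 'End(V)).
Hypothesis fg : g =1 f.
Implicit Types zs : seq (V * nat).
Local Notation strings zs := (flatten [seq traject f z.1 z.2 | z <- zs]).

Lemma strings_stable zs : {in zs, forall z, iter z.2 f z.1 = 0} ->
  (g @: <<strings zs>> <= <<strings zs>>)%VS.
Proof.
move=> h0; rewrite limg_span; apply/span_subvP => _ /mapP[w /flatten_mapP[s hs hw] ->].
case/trajectP: hw => j ltj ->; rewrite fg -iterS.
have [ltj1|] := ltnP j.+1 s.2; last first.
  move=> gej; have <- : s.2 = j.+1 by apply/eqP; rewrite eqn_leq gej.
  by rewrite h0 // mem0v.
by apply/memv_span/flatten_mapP; exists s => //; apply/trajectP; exists j.+1.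
Qed.

Lemma strings_head zs z : z \in zs -> (0 < z.2)%N -> z.1 \in <<strings zs>>%VS.
Proof.
move=> hz gt0; apply/memv_span/flatten_mapP; exists z => //.
by apply/trajectP; exists 0%N.
Qed.

Lemma size_strings zs : size (strings zs) = sumn (unzip2 zs).
Proof.
rewrite size_flatten; congr sumn; rewrite /shape -map_comp.
by apply: eq_map => z /=; rewrite size_traject.
Qed.

(** A spanning family with at most as many members as the dimension is a basis, so the freeness of
    the strings never has to be proved directly. *)
Lemma jordan_basis_span zs : {in zs, forall z, 0 < z.2}%N ->
  {in zs, forall z, iter z.2 f z.1 = 0} ->
  (fullv <= <<strings zs>>)%VS -> (sumn (unzip2 zs) <= \dim {:V})%N ->
  jordan_basis f zs.
Proof. by move=> h1 h2 h3 h4; split=> //; rewrite basisEdim h3 size_strings. Qed.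

Lemma iter_lin k : exists h : 'End(V), h =1 iter k f.
Proof.
elim: k => [|k [h hE]]; first by exists \1%VF => w; rewrite id_lfunE.
by exists (g \o h)%VF => w; rewrite comp_lfunE hE fg.
Qed.

(* The last vector of a string of length p is not in the image of f^p, which is
   spanned by the vectors at positions >= p of the strings. *)
Lemma string_last zs z p w : jordan_basis f zs -> (z, p) \in zs ->
  iter p.-1 f z <> iter p f w.
Proof.
move=> [hpos h0 hb] hz e.
have p_gt0 : (0 < p)%N := hpos _ hz.
case/splitPr: zs / hz hpos h0 hb => zs1 zs2 hpos h0.
rewrite map_cat flatten_cat /= => hb.
have tE : traject f z p = rcons (traject f z p.-1) (iter p.-1 f z).
  by rewrite -trajectSr prednK.
(* With the last vector of the chosen string moved to the front, freeness says that it is not in the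
   span of the rest [Y]. *)
set X := _ ++ _ in hb; pose Y := strings zs1 ++ traject f z p.-1 ++ strings zs2.
have pXY : perm_eq X (iter p.-1 f z :: Y).
  by apply/permP => a; rewrite /X /Y tE /= !count_cat -cats1 count_cat /=; lia.
have := basis_free hb; rewrite (perm_free pXY) free_cons => /andP[/negP + _]; apply.
have [h hE] := iter_lin p; rewrite e -hE.
have : h w \in (h @: <<X>>)%VS by rewrite memv_img // (span_basis hb) memvf.
apply: subvP; rewrite limg_span; apply/span_subvP => _ /mapP[b hbX ->].
rewrite hE; have other zs' s : s \in zs' -> iter s.2 f s.1 = 0 -> b \in traject f s.1 s.2 ->
    {subset strings zs' <= Y} -> iter p f b \in <<Y>>%VS.
  move=> hs hs0 /trajectP[j ltj ->] sub; rewrite -iterD.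
  have [lt|ge] := ltnP (p + j) s.2; last first.
    rewrite -(subnK ge) iterD hs0.
    have [h' h'E] := iter_lin (p + j - s.2); rewrite -h'E linear0; exact: mem0v.
  apply/memv_span/sub/flatten_mapP; exists s => //.
  by apply/trajectP; exists (p + j)%N.
move: hbX; rewrite /X !mem_cat => /or3P[/flatten_mapP[s hs]||/flatten_mapP[s hs]].
- move=> hb'; apply: (other zs1 s hs _ hb'); first by rewrite h0 // mem_cat hs.
  by move=> c hc; rewrite mem_cat hc.
- case/trajectP => j ltj ->; rewrite -iterD addnC iterD.
  have -> : iter p f z = 0 by apply: (h0 (z, p)); rewrite mem_cat inE eqxx orbT.
  by have [h' h'E] := iter_lin j; rewrite -h'E linear0 mem0v.
- move=> hb'; apply: (other zs2 s hs _ hb').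
    by rewrite h0 // mem_cat inE hs !orbT.
  by move=> c hc; rewrite !mem_cat hc !orbT.
Qed.

End JordanStrings.

(** * Weak Lefschetz elements *)

Section LinearGenerators.
Variables (K : fieldType) (F : {mpoly K[5]}).
Local Notation A := (apolar_alg F).
Variables (x y z u v : A).
Local Notation gens := [:: x; y; z; u; v].
Local Notation N := <<[:: x; y; z]>>%VS.

Lemma spanN n : n \in N -> exists c1 c2 c3, n = c1 *: x + c2 *: y + c3 *: z.
Proof.
rewrite !span_cons span_nil addv0.
case/memv_addP => _ /vlineP[c1 ->] [_ /memv_addP[_ /vlineP[c2 ->] [_ /vlineP[c3 ->] ->]] ->].
by exists c1, c2, c3; rewrite addrA.
Qed.

Section Span.
Hypothesis (span_e : apolar_comp F 1 = <<gens>>%VS).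

Lemma gen_comp1 (a : A) : a \in gens -> a \in apolar_comp F 1.
Proof. by move=> ha; rewrite span_e memv_span. Qed.

Lemma N_comp1 n : n \in N -> n \in apolar_comp F 1.
Proof.
move=> hn; rewrite span_e -[gens]/([:: x; y; z] ++ [:: u; v]) span_cat.
exact: (subvP (addvSl _ _)).
Qed.

Lemma comp1_coords (a : A) : a \in apolar_comp F 1 ->
  exists n c c', n \in N /\ a = n + c *: u + c' *: v.
Proof.
rewrite span_e -[gens]/([:: x; y; z] ++ [:: u; v]) span_cat.
case/memv_addP => n nN [b]; rewrite span_cons span_seq1.
case/memv_addP => _ /vlineP[c ->] [_ /vlineP[c' ->] ->] ->.
by exists n, c, c'; rewrite addrA.
Qed.

End Span.

(** Every term of the expansion that involves [m] contains the product [m * n], which is 0. *)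
Lemma expr_on_N (a m n : A) i : (forall b c, b \in N -> c \in N -> b * c = 0) ->
  m \in N -> n \in N -> (a + m) ^+ i * n = a ^+ i * n.
Proof.
move=> NN hm hn; elim: i => [|i IH]; first by rewrite !expr0.
by rewrite !exprS -!mulrA IH mulrDl [m * _]mulrCA (NN _ _ hm hn) mulr0 addr0.
Qed.

End LinearGenerators.

Section Lefschetz.
Variables (K : closedFieldType) (d : nat) (F : {mpoly K[5]}).
Hypotheses (charK : [pchar K] =i pred0) (homF : F \is d.-homog).
Hypothesis (d_ge5 : (5 <= d)%N).
Hypothesis (hilbF : forall i : nat, hilbert F i = nth 0%N (min_hilbert_seq d) i).
Local Notation A := (apolar_alg F).
Local Notation Ac := (apolar_comp F).
Local Notation sigma := (@socle_form 4 K F).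

Implicit Types (f g h : {poly K}).

Lemma hilbert_mid i : (2 <= i <= d - 2)%N -> hilbert F i = 6%N.
Proof.
rewrite hilbF /min_hilbert_seq nth_cat /= => h; rewrite ifF; last by lia.
by rewrite nth_cat size_nseq nth_nseq (_ : i - 2 < d - 3)%N //; lia.
Qed.

Lemma hilbert_top i : (i < 2)%N -> hilbert F (d - i) = nth 0%N [:: 1; 5] i.
Proof.
move=> lti; rewrite hilbF.
have -> : (d - i = 2 + (d - 3 + (1 - i)))%N by lia.
rewrite /min_hilbert_seq nth_cat ltnNge leq_addr /= addKn.
rewrite nth_cat size_nseq ltnNge leq_addr /= addKn.
by case: i lti => [|[]].
Qed.

Lemma sum_hilbert : (\sum_(i < d.+1) hilbert F i = 6 * d - 6)%N.
Proof.
under eq_bigr do rewrite hilbF.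
have -> : d.+1 = size (min_hilbert_seq d).
  by rewrite /min_hilbert_seq !size_cat size_nseq /=; lia.
transitivity (\sum_(k <- min_hilbert_seq d) k)%N.
  by rewrite [RHS](big_nth 0%N) big_mkord.
rewrite /min_hilbert_seq !big_cat /= !big_cons !big_nil.
by rewrite big_nseq iter_addn; lia.
Qed.

Variables (x y z u v : A).
Local Notation N := <<[:: x; y; z]>>%VS.
Hypothesis (span_e : Ac 1 = <<[:: x; y; z; u; v]>>%VS).
Hypothesis (NN : forall a b, a \in N -> b \in N -> a * b = 0).

Lemma u_comp1 : u \in Ac 1. Proof. by apply: (gen_comp1 span_e); rewrite !inE eqxx !orbT. Qed.
Lemma v_comp1 : v \in Ac 1. Proof. by apply: (gen_comp1 span_e); rewrite !inE eqxx !orbT. Qed.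

(** * The subspaces N A_i and the annihilator of N *)

Definition NA i : {vspace A} :=
  (amul x @: Ac i + amul y @: Ac i + amul z @: Ac i)%VS.

Lemma NA_sub i (W : {vspace A}) :
  (forall n a, n \in N -> a \in Ac i -> n * a \in W) -> (NA i <= W)%VS.
Proof.
move=> h; rewrite !subv_add -!andbA; apply/and3P; split; apply/subvP => _
  /memv_imgP[a ha ->]; rewrite amulE h // memv_span // !inE eqxx ?orbT //.
Qed.

Lemma N_ind (P : A -> Prop) :
  P x -> P y -> P z ->
  (forall c a b, P a -> P b -> P (c *: a + b)) -> forall n, n \in N -> P n.
Proof.
move=> Px Py Pz PP n; rewrite !span_cons span_nil addv0.
case/memv_addP => _ /vlineP[a ->] [_ /memv_addP[_ /vlineP[b ->] [_ /vlineP[c ->] ->]] ->].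
have P0 : P 0 by have := PP (-1) _ _ Px Px; rewrite scaleN1r addNr.
by apply: (PP) => //; apply: (PP) => //; rewrite -[c *: z]addr0; apply: (PP).
Qed.

Lemma NA_mem i n a : n \in N -> a \in Ac i -> n * a \in NA i.
Proof.
move=> hn ha; apply: (N_ind (P := fun n => n * a \in NA i)) hn => [|||c m m' hm hm'].
- rewrite -amulE; apply: (subvP (addvSl _ _)); apply: (subvP (addvSl _ _)).
  exact: memv_img.
- rewrite -amulE; apply: (subvP (addvSl _ _)); apply: (subvP (addvSr _ _)).
  exact: memv_img.
- by rewrite -amulE; apply: (subvP (addvSr _ _)); apply: memv_img.
- by rewrite mulrDl -apolar_scalerAl rpredD // rpredZ.
Qed.

Lemma NA_comp i : (NA i <= Ac i.+1)%VS.
Proof. by apply: NA_sub => n a hn ha; rewrite comp_mul1 ?(N_comp1 span_e). Qed.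

Lemma NA_mul i l w : l \in Ac 1 -> w \in NA i -> l * w \in NA i.+1.
Proof.
move=> ell_comp1 hw; suff : (NA i <= amul l @^-1: NA i.+1)%VS.
  by move=> /subvP/(_ w hw); rewrite -memv_preim amulE.
apply: NA_sub => n a hn ha; rewrite -memv_preim amulE mulrCA NA_mem //.
exact: comp_mul1.
Qed.

Lemma N_NA i n w : n \in N -> w \in NA i -> n * w = 0.
Proof.
move=> hn hw; suff : (NA i <= amul n @^-1: 0)%VS.
  by move=> /subvP/(_ w hw); rewrite -memv_preim amulE memv0 => /eqP.
apply: NA_sub => n' a hn' ha; rewrite -memv_preim amulE mulrA (NN hn hn') mul0r.
exact: mem0v.
Qed.

Definition theta_fun (a : A) : A * A * A := (x * a, y * a, z * a).

Fact theta_linear : linear theta_fun.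
Proof. by move=> c a b; rewrite /theta_fun !mulrDr -!apolar_scalerAr. Qed.

HB.instance Definition _ :=
  GRing.isLinear.Build K A (A * A * A)%type _ theta_fun theta_linear.

(** The annihilator of [N] becomes the kernel of one linear map. Since N A is killed, the rank [b i]
    of [theta] on A_i is the dimension of K[u, v] / I in degree [i]. *)
Definition theta : 'Hom(A, (A * A * A)%type) := linfun theta_fun.

Lemma theta0P a : theta a = 0 <-> forall n, n \in N -> n * a = 0.
Proof.
rewrite lfunE /= /theta_fun; split=> [[hx hy hz] n hn|h].
  by apply: (N_ind (P := fun n => n * a = 0)) hn => // c m m' hm hm';
    rewrite mulrDl -apolar_scalerAl hm hm' scaler0 addr0.
by rewrite !h // memv_span // !inE eqxx ?orbT.
Qed.

Lemma thetaM l a : theta a = 0 -> theta (l * a) = 0.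
Proof. by move=> /theta0P h; apply/theta0P => n hn; rewrite mulrCA h // mulr0. Qed.

Lemma theta_N n a : n \in N -> theta (n * a) = 0.
Proof. by move=> hn; apply/theta0P => m hm; rewrite mulrA (NN hm hn) mul0r. Qed.

Local Notation b i := (\dim (theta @: Ac i)).
Local Notation Z i := (Ac i :&: lker theta)%VS.

Lemma NA_Z i : (NA i <= Z i.+1)%VS.
Proof.
rewrite subv_cap NA_comp; apply: NA_sub => n a hn ha.
by rewrite memv_ker theta_N.
Qed.

(** Duality: if [a] is orthogonal to N A_i, then each [n * a] with [n] in [N] is orthogonal to A_i,
    hence zero, so that [theta] kills [a]. *)
Lemma dim_theta_NA i : (i < d)%N -> (b (d - i.+1) <= \dim (NA i))%N.
Proof.
move=> lti; apply: pair_dim => a ha h; apply/theta0P => n hn.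
have hna : n * a \in Ac (d - i).
  by rewrite -(subnSK lti) comp_mul1 ?(N_comp1 span_e).
apply: (socle_form_nondeg charK homF hna); first exact: leq_subr.
by rewrite subKn 1?ltnW // => c hc; rewrite mulrAC mulrC h // NA_mem.
Qed.

(** A_1 has dimension 5 and is spanned by five elements, so [u] and [v] contribute at most 2 and
    leave 3 for [N]. *)
Lemma dim_N : \dim N = 3%N.
Proof.
have h5 : \dim (Ac 1) = 5%N by rewrite -[LHS]/(hilbert F 1) hilbF.
apply/eqP; rewrite eqn_leq dim_span /=.
move: h5; rewrite span_e -[_ :: _]/([:: x; y; z] ++ [:: u; v]) span_cat => h5.
have := (dimv_add_leqif N <<[:: u; v]>>%VS).1; rewrite h5.
by have /= := dim_span [:: u; v]; lia.
Qed.

(** Pair [N] with a complement of the kernel of [theta] in A_{d-1}. The kernel itself is killed by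
    [N], so an element of [N] orthogonal to the complement is orthogonal to all of A_{d-1}, hence
    zero. *)
Lemma dim_theta_d1 : (3 <= b (d - 1))%N.
Proof.
suff : (\dim (\1 @: N) <= b (d - 1))%N by rewrite lim1g dim_N.
rewrite -(leq_add2l (\dim (Z (d - 1)))) limg_ker_dim.
rewrite -(dimv_cap_compl (Ac (d - 1)) (lker theta)) leq_add2l.
apply: pair_dim => a ha h; rewrite id_lfunE.
apply: (socle_form_nondeg charK homF (N_comp1 span_e ha)) => [|c]; first by lia.
rewrite -{1}(addv_diff_cap (Ac (d - 1)) (lker theta)).
case/memv_addP => c1 hc1 [c2]; rewrite memv_cap memv_ker => /andP[_ /eqP/theta0P h2] ->.
by rewrite mulrDr h2 // addr0 h.
Qed.

(** * Binary forms in u and v, and the dimensions of K[u, v] / I *)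

Definition binform i (f : {poly K}) : A :=
  \sum_(j < i.+1) f`_j *: (u ^+ j * v ^+ (i - j)).

Fact binform_linear i : linear (binform i).
Proof.
move=> c f g; rewrite /binform scaler_sumr -big_split; apply: eq_bigr => j _.
by rewrite coefD coefZ scalerDl scalerA.
Qed.

HB.instance Definition _ i :=
  GRing.isLinear.Build K {poly K} A _ (binform i) (binform_linear i).

Lemma binform_comp i f : binform i f \in Ac i.
Proof.
apply: rpred_sum => j _; apply: rpredZ.
have := comp_mul (comp_exp j u_comp1) (comp_exp (i - j) v_comp1).
by rewrite subnKC // leq_ord.
Qed.

Lemma size_XM i f : (size f <= i)%N -> (size ('X * f)%R <= i.+1)%N.
Proof.
by move=> sf; rewrite (leq_trans (size_polyMleq _ _)) // size_polyX addSn.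
Qed.

Lemma binformX i f : binform i.+1 ('X * f) = u * binform i f.
Proof.
rewrite /binform big_ord_recl coefXM eqxx scale0r add0r mulr_sumr.
apply: eq_bigr => j _; rewrite coefXM /= -apolar_scalerAr.
by rewrite mulrA -exprS.
Qed.

(** The polynomial is the binary form dehomogenized at v = 1, so multiplication by [v] leaves it
    unchanged. The size bound excludes a coefficient at u^(i+1), which would count on the left
    only. *)
Lemma binformV i f : (size f <= i.+1)%N -> binform i.+1 f = v * binform i f.
Proof.
move=> sf; rewrite /binform big_ord_recr /= nth_default // scale0r addr0 mulr_sumr.
apply: eq_bigr => j _ /=; rewrite -apolar_scalerAr mulrCA -exprS subSn //.
exact: leq_ord.
Qed.

Lemma binformVn i k f : (size f <= i.+1)%N -> binform (k + i)%N f = v ^+ k * binform i f.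
Proof.
move=> sf; elim: k => [|k IH]; first by rewrite mul1r.
rewrite addSn binformV ?IH ?exprS ?mulrA //; lia.
Qed.

Lemma binformXsubC i f t : (size f <= i.+1)%N ->
  binform i.+1 (('X - t%:P) * f) = (u - t *: v) * binform i f.
Proof.
move=> sf; rewrite mulrBl linearB /= binformX mul_polyC linearZ /= binformV //.
by rewrite mulrBl -apolar_scalerAl.
Qed.

Definition binform_mx i (r : 'rV[K]_i.+1) : A := binform i (rVpoly r).

Fact binform_mx_linear i : linear (@binform_mx i).
Proof. by move=> c r s; rewrite /binform_mx !linearP. Qed.

HB.instance Definition _ i :=
  GRing.isLinear.Build K 'rV[K]_i.+1 A _ (@binform_mx i) (@binform_mx_linear i).

Lemma binform_mxE i r : linfun (@binform_mx i) r = binform i (rVpoly r).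
Proof. by rewrite lfunE. Qed.

Definition binforms i : {vspace A} := limg (linfun (@binform_mx i)).

Lemma mem_binforms i f : (size f <= i.+1)%N -> binform i f \in binforms i.
Proof.
move=> sf; apply/memv_imgP; exists (poly_rV f); first exact: memvf.
by rewrite binform_mxE poly_rV_K.
Qed.

Lemma binformsP i s : s \in binforms i -> exists2 f : {poly K}, (size f <= i.+1)%N & s = binform i f.
Proof.
case/memv_imgP => r _ ->; exists (rVpoly r); first exact: size_poly.
by rewrite binform_mxE.
Qed.

Lemma comp0_sub_binforms : (Ac 0 <= binforms 0)%VS.
Proof.
apply/subvP => _ /comp0_scalar[c ->]; apply: rpredZ.
suff -> : (1 : A) = binform 0 1 by rewrite mem_binforms // size_poly1.
by rewrite /binform big_ord1 coefC eqxx scale1r mulr1.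
Qed.

(** A product with a factor in [N] lies in N A, and products of [u] and [v] alone are binary forms;
    the induction follows this dichotomy. *)
Lemma compS_sub_binforms i : (Ac i.+1 <= binforms i.+1 + NA i)%VS.
Proof.
elim: i => [|i IH]; apply: compS_sub => a c /(comp1_coords span_e)[m [k [k' [hm ->]]]];
  rewrite -addrA addrC.
- move=> hc; rewrite mulrDl; apply: memv_add; last exact: NA_mem.
  have /(subvP comp0_sub_binforms)/binformsP[f sf ->] := hc.
  rewrite mulrDl -!apolar_scalerAl -binformX -binformV //.
  by apply: rpredD; apply: rpredZ; apply: mem_binforms; [apply: size_XM | apply: leqW].
- move=> hc; have /(subvP IH)/memv_addP[s hs [w hw cE]] := hc.
  have [f sf sE] := binformsP hs.
  have ell_comp1 : k *: u + k' *: v \in Ac 1 by rewrite rpredD // rpredZ ?u_comp1 ?v_comp1.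
  rewrite mulrDl {1}cE mulrDr -addrA; apply: memv_add; last first.
    by apply: rpredD; [apply: NA_mul | apply: NA_mem].
  rewrite sE mulrDl -!apolar_scalerAl -binformX -binformV //.
  by apply: rpredD; apply: rpredZ; apply: mem_binforms; [apply: size_XM | apply: leqW].
Qed.

Lemma theta_binforms i : (theta @: Ac i = theta @: binforms i)%VS.
Proof.
have subS : (binforms i <= Ac i)%VS by apply/subvP => s /binformsP[f _ ->]; apply: binform_comp.
apply/eqP; rewrite eqEsubv (limgS _ subS) andbT.
case: i {subS} => [|i]; first by rewrite limgS // comp0_sub_binforms.
rewrite (subv_trans (limgS _ (compS_sub_binforms i))) // limgD subv_add subvv /=.
apply/subvP => _ /memv_imgP[w hw ->].
have /(subvP (NA_Z i)) := hw; rewrite memv_cap memv_ker => /andP[_ /eqP ->].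
exact: mem0v.
Qed.

(** A binary form of degree [i] has i + 1 coefficients, so a rank of at most [i] leaves a nonzero
    form that kills [N]. *)
Lemma exists_relation i : (b i <= i)%N ->
  exists g : {poly K}, [/\ g != 0, (size g <= i.+1)%N & theta (binform i g) = 0].
Proof.
rewrite theta_binforms -limg_comp => bi.
pose f := (theta \o linfun (@binform_mx i))%VF.
have := limg_ker_dim f fullv; rewrite capfv dimvf dim_matrix mul1r => dimE.
have : lker f != 0%VS by rewrite -dimv_eq0; move: bi; rewrite -/f; lia.
rewrite -vpick0 => nz; exists (rVpoly (vpick (lker f))); split.
- by apply: contraNneq nz => /(congr1 (poly_rV (d := i.+1))); rewrite rVpolyK linear0 => ->.
- exact: size_poly.
- by have := memv_pick (lker f); rewrite memv_ker comp_lfunE binform_mxE => /eqP.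
Qed.

(** Subtracting a multiple of the relation [g] from a form makes it vanish at [t], hence divisible
    by u - t v; the subtracted part is invisible to [theta]. *)
Lemma theta_surj i g t k : (size g <= i.+1)%N -> g.[t] != 0 ->
  theta (binform i g) = 0 -> (i <= k.+1)%N ->
  (theta @: Ac k.+1 <= theta @: (amul (u - t *: v) @: Ac k))%VS.
Proof.
move=> sg gt hg lei; rewrite theta_binforms; apply/subvP => _ /memv_imgP[_ /binformsP[f sf ->] ->].
pose c := f.[t] / g.[t].
have : root (f - c *: g) t.
  by rewrite rootE !hornerE /c mulrVK ?unitfE // subrr.
case/factor_theorem => h; rewrite mulrC => fE.
have sh : (size h <= k.+1)%N.
  have [->|nz] := eqVneq h 0; first by rewrite size_poly0.
  have : (size (f - c *: g)%R <= k.+2)%N.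
    rewrite (leq_trans (size_polyD _ _)) // size_polyN geq_max sf.
    rewrite (leq_trans (size_scale_leq _ _)) // (leq_trans sg) //.
  by rewrite fE size_monicM ?monicXsubC // size_XsubC.
have -> : theta (binform k.+1 f) = theta ((u - t *: v) * binform k h).
  (* Read in degree k + 1, the same polynomial [g] is the relation multiplied by a power of [v]. *)
  have hgk : theta (binform k.+1 g) = 0.
    by rewrite -(subnK lei) binformVn // thetaM.
  apply/eqP; rewrite -subr_eq0 -linearB; apply/eqP/theta0P => n hn.
  rewrite -binformXsubC // -fE -linearB subKr linearZ /= -apolar_scalerAr.
  by rewrite ((theta0P _).1 hgk n hn) scaler0.
by apply: memv_img; rewrite -amulE memv_img // binform_comp.
Qed.

(** A smaller rank in degree [i] gives a relation [g] there. Multiplication by u - t v, with [t] not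
    a root of [g], is then onto modulo the kernel of [theta] from degree [i] on, so the ranks cannot
    grow back to the value at least 3 in degree d - 1. *)
Lemma theta_dim_ge i : (i < d)%N -> (minn i.+1 3 <= b i)%N.
Proof.
move=> lti; rewrite leqNgt; apply/negP => ltb.
have bi : (b i <= i)%N by lia.
have [g [nz sg hg]] := exists_relation bi.
have [t] := closed_nonrootP _ nz; rewrite rootE => gt.
have dec k : (i <= k)%N -> (b k <= b i)%N.
  move=> leik; rewrite -(subnK leik); elim: (k - i)%N => // e IH.
  rewrite addSn (leq_trans (dimvS (theta_surj sg gt hg _))) //; first lia.
  have : (lker (theta) <= lker (theta \o amul (u - t *: v)))%VS.
    apply/subvP => a; rewrite !memv_ker comp_lfunE amulE => /eqP ha.
    by apply/eqP; apply: thetaM.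
  move=> hker; rewrite -limg_comp (leq_trans _ IH) //.
  rewrite -(leq_add2l (\dim (Z (e + i)))) limg_ker_dim.
  rewrite -(limg_ker_dim (theta \o amul (u - t *: v)) (Ac (e + i))) leq_add2r.
  by apply: dimvS; apply: capvS.
by have := dec (d - 1)%N; have := dim_theta_d1; lia.
Qed.

(** A squeeze: the Hilbert function at [i] is the sum of [b i] and the dimension of [Z i], which
    contains N A_{i-1}, of dimension at least [b (d - i)]. The lower bounds for [b i] and
    [b (d - i)] already add up to the Hilbert function. *)
Lemma theta_dim i : (0 < i < d)%N -> b i = minn i.+1 3 /\ Z i = NA i.-1.
Proof.
move=> hi; have := limg_ker_dim theta (Ac i); rewrite -/(hilbert F i) => dimE.
have := theta_dim_ge (_ : i < d)%N => /(_ ltac:(lia)) b1.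
have := theta_dim_ge (_ : d - i < d)%N => /(_ ltac:(lia)) b2.
have := dim_theta_NA (_ : i.-1 < d)%N => /(_ ltac:(lia)).
rewrite prednK; last by lia.
have := NA_Z i.-1; rewrite prednK; last by lia.
move=> subZ b3; have leZ := dimvS subZ.
have hE : (hilbert F i <= minn i.+1 3 + minn (d - i).+1 3)%N.
  have [->|i1] := eqVneq i 1%N; first by rewrite hilbF /=; lia.
  have [->|i2] := eqVneq i (d - 1)%N; first by rewrite (@hilbert_top 1) //=; lia.
  by rewrite hilbert_mid; lia.
have arith (h zi bi na b' m m' : nat) : (zi + bi = h -> m <= bi -> m' <= b' ->
  b' <= na -> na <= zi -> h <= m + m' -> bi = m /\ zi <= na)%N by lia.
have [-> le] := arith _ _ _ _ _ _ _ dimE b1 b2 b3 leZ hE.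
by split=> //; apply/esym/eqP; rewrite eqEdim subZ.
Qed.

Lemma NA_theta0 i w a : w \in NA i -> theta a = 0 -> w * a = 0.
Proof.
move=> hw /theta0P h; suff : (NA i <= lker (amul a))%VS.
  by move/subvP/(_ w hw); rewrite memv_ker amulE mulrC => /eqP.
apply: NA_sub => n c hn hc; rewrite memv_ker amulE mulrCA mulrA h //.
by rewrite mul0r.
Qed.

Lemma socle_form_eq0 a : a \in Ac d -> sigma a = 0 -> a = 0.
Proof.
move=> ha sa; apply: (socle_form_nondeg charK homF ha) => // b.
rewrite subnn => /comp0_scalar[c ->].
by rewrite -apolar_scalerAr mulr1 linearZ /= sa scaler0.
Qed.

Lemma socle_prop a c : a \in Ac d -> c \in Ac d -> c != 0 ->
  exists k : K, a = k *: c.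
Proof.
move=> ha hc nz; exists (sigma a / sigma c); apply/eqP; rewrite -subr_eq0.
apply/eqP/socle_form_eq0; first by rewrite rpredB // rpredZ.
rewrite linearB linearZ /=.
have sc : sigma c != 0 by apply: contra_neq nz; apply: socle_form_eq0.
by apply/eqP; rewrite subr_eq0; apply/eqP; rewrite [RHS]mulrVK ?unitfE.
Qed.

(** * Linear forms whose part in u, v does not divide the cubic relation *)

Section NonRoot.
Variables (q : {poly K}) (t : K).
Hypotheses (size_q : (size q <= 4)%N) (qt : q.[t] != 0).
Hypothesis (hq : theta (binform 3 q) = 0).
Local Notation l' := (u - t *: v).

Lemma factor_comp1 : l' \in Ac 1. Proof. by rewrite rpredB ?rpredZ ?u_comp1 ?v_comp1. Qed.

Lemma theta_lift k a : (2 <= k)%N -> a \in Ac k.+1 ->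
  exists2 c, c \in Ac k & theta (a - l' * c) = 0.
Proof.
move=> lek ha; have := theta_surj size_q qt hq (_ : 3 <= k.+1)%N => /(_ lek).
move=> /subvP/(_ _ (memv_img theta ha)) /memv_imgP[_ /memv_imgP[c hc ->] e].
by exists c => //; rewrite linearB /= e amulE subrr.
Qed.

(** For these [k], multiplication by l' is onto modulo the kernel of [theta] between spaces of the
    same dimension 3, hence injective. *)
Lemma theta_inj2 k a : (2 <= k <= d - 2)%N -> a \in Ac k ->
  theta (l' * a) = 0 -> theta a = 0.
Proof.
move=> hk ha h0; pose g := (theta \o amul l')%VF.
have subZ : (Z k <= Ac k :&: lker g)%VS.
  apply: capvS => //; apply/subvP => c; rewrite !memv_ker comp_lfunE amulE.
  by move=> /eqP hc; apply/eqP; apply: thetaM.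
have := theta_surj size_q qt hq (_ : 3 <= k.+1)%N => /(_ ltac:(lia)).
rewrite -limg_comp -/g => /dimvS.
have hk0 : (0 < k < d)%N by lia.
have hk1 : (0 < k.+1 < d)%N by lia.
have [-> _] := theta_dim hk1 => e2.
have := limg_ker_dim theta (Ac k); have [-> _] := theta_dim hk0 => e1.
have := limg_ker_dim g (Ac k); rewrite -e1 => e3.
have arith (p r w : nat) : (p + r = w + minn k.+1 3 -> minn k.+2 3 <= r -> p <= w)%N.
  by lia.
have eZ : (Z k == Ac k :&: lker g)%VS by rewrite eqEdim subZ; apply: arith e3 e2.
have : a \in (Ac k :&: lker g)%VS.
  by rewrite memv_cap ha memv_ker comp_lfunE amulE h0 eqxx.
by rewrite -(eqP eZ) memv_cap memv_ker => /andP[_ /eqP].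
Qed.

Lemma theta_inj k a : (1 <= k <= d - 2)%N -> a \in Ac k ->
  theta (l' * a) = 0 -> theta a = 0.
Proof.
(* For [k] = 1 the ranks are 2 and 3, so the counting fails. Instead [n * a] is paired with A_{d-2},
   whose elements are multiples of l' up to the kernel of [theta]. *)
have [->|k1] := eqVneq k 1%N; last by move=> hk; apply: theta_inj2; lia.
move=> _ ha /theta0P h; apply/theta0P => n hn.
have hna : n * a \in Ac 2 by rewrite comp_mul1 // (N_comp1 span_e).
apply: (socle_form_nondeg charK homF hna); first by lia.
rewrite (_ : d - 2 = (d - 3).+1)%N; last by lia.
move=> c /theta_lift[|c' hc' /theta0P/(_ n hn)]; first by lia.
rewrite mulrBr => /eqP; rewrite subr_eq0 => /eqP e.
have -> : n * a * c = 0; last by rewrite linear0.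
by rewrite mulrAC e -mulrA -mulrA [c' * a]mulrC mulrA mulrA -(mulrA n) h // mul0r.
Qed.

(** Dual to [theta_lift]: [w] is tested against elements that are multiples of l' up to the kernel
    of [theta], and that kernel is killed by N A. *)
Lemma NA_inj i w : (i.+1 <= d - 3)%N -> w \in NA i -> l' * w = 0 -> w = 0.
Proof.
move=> lei hw h0; have hwc := subvP (NA_comp i) _ hw.
apply: (socle_form_nondeg charK homF hwc); first by lia.
rewrite (_ : d - i.+1 = (d - i.+2).+1)%N; last by lia.
move=> c /theta_lift[|c' hc' e]; first by lia.
have /eqP := NA_theta0 hw e; rewrite mulrBr subr_eq0 => /eqP ->.
by rewrite mulrCA mulrA h0 mul0r linear0.
Qed.

(** Injectivity strips off the factors l' one at a time. In the end [theta l' = 0] would make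
    [theta] vanish on A_1, where its rank is 2. *)
Lemma theta_exp : theta (l' ^+ (d - 1)) <> 0.
Proof.
suff H k : (k <= d - 2)%N -> theta (l' ^+ k.+1) <> 0.
  by rewrite (_ : d - 1 = (d - 2).+1)%N; [apply: H | lia].
elim: k => [|k IH] lek h.
  have h1 : (0 < 1 < d)%N by lia.
  have [b1 _] := theta_dim h1.
  have : (theta @: Ac 1 <= 0)%VS.
    apply/subvP => _ /memv_imgP[a ha ->]; rewrite (theta_inj _ ha) ?mem0v //.
      by lia.
    by rewrite mulrC thetaM.
  move=> /dimvS; rewrite dimv0 b1 //; lia.
apply: IH; first by lia.
by apply: (theta_inj _ (comp_exp _ factor_comp1)); [lia | rewrite -exprS].
Qed.

(** This [n] has two uses: adding multiples of it to l' moves the value of [sigma] at the d-th power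
    freely, and it heads the second string of length [d] in the shorter Jordan type. *)
Lemma exists_dual : exists2 n, n \in N & sigma (n * l' ^+ (d - 1)) != 0.
Proof.
have [hx|] := boolP [&& sigma (x * l' ^+ (d - 1)) == 0,
  sigma (y * l' ^+ (d - 1)) == 0 & sigma (z * l' ^+ (d - 1)) == 0]; last first.
  by rewrite !negb_and => /or3P[] h;
    [exists x | exists y | exists z] => //; rewrite memv_span // !inE eqxx ?orbT.
case: theta_exp; case/and3P: hx => /eqP hx /eqP hy /eqP hz.
have e n : n \in N -> n * l' ^+ (d - 1) \in Ac d.
  move=> hn; have := comp_mul1 (N_comp1 span_e hn) (comp_exp (d - 1) factor_comp1).
  by rewrite subn1 prednK //; lia.
apply/theta0P => n hn; apply: socle_form_eq0; first exact: e.
apply: (N_ind (P := fun n => sigma (n * l' ^+ (d - 1)) = 0)) hn => //.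
move=> c a b ha hb; rewrite mulrDl -apolar_scalerAl linearP /= ha hb.
by rewrite scaler0 addr0.
Qed.

Variable m : A.
Hypothesis hm : m \in N.
Local Notation l := (l' + m).

Lemma ell_comp1 : l \in Ac 1. Proof. by rewrite rpredD ?factor_comp1 ?(N_comp1 span_e). Qed.

(** If [l * a = 0], then l' a is killed by [N] since N^2 = 0, so [a] is in Z_i = N A_{i-1}; there
    [l] acts as l', which is injective. *)
Lemma l_inj i a : (1 <= i <= d - 3)%N -> a \in Ac i -> l * a = 0 -> a = 0.
Proof.
move=> hi ha h0; have hz : a \in Z i.
  rewrite memv_cap ha memv_ker; apply/eqP/(theta_inj _ ha); first by lia.
  apply/theta0P => n hn; have : n * (l * a) = 0 by rewrite h0 mulr0.
  by rewrite mulrDl mulrDr [n * (m * a)]mulrA (NN hn hm) mul0r addr0.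
have hi' : (0 < i < d)%N by lia.
move: hz; have [_ ->] := theta_dim hi'.
move=> hz; apply: (NA_inj _ hz); first by lia.
by move: h0; rewrite mulrDl (N_NA hm hz) addr0.
Qed.

Lemma l_inj01 i a : (i < 2)%N -> a \in Ac i -> l * a = 0 -> a = 0.
Proof.
move=> lti; have [->|ne] := eqVneq i 1%N; first by apply: l_inj; lia.
have -> : i = 0%N by lia.
move=> /comp0_scalar[c ->]; rewrite -apolar_scalerAr mulr1 => /eqP.
rewrite scaler_eq0 => /orP[/eqP->|/eqP l0]; first by rewrite scale0r.
(* If [l] were zero, its injectivity on A_1 would force A_1 = 0. *)
have : Ac 1 = 0%VS.
  apply/eqP; rewrite -vpick0; apply/eqP/(l_inj _ (memv_pick _)); first by lia.
  by rewrite l0 mul0r.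
by move/(congr1 (fun W : {vspace A} => \dim W)); rewrite dimv0 -/(hilbert F 1) hilbF.
Qed.

(** Up to degree d - 3, injectivity between spaces of dimension 6 suffices. For i = d - 2 and i = d
    - 1, surjectivity is dual to injectivity in the degrees 1 and 0. *)
Lemma l_surj i : (2 <= i < d)%N -> (amul l @: Ac i)%VS = Ac i.+1.
Proof.
move=> hi; have sub : (amul l @: Ac i <= Ac i.+1)%VS.
  by apply/subvP => _ /memv_imgP[a ha ->]; rewrite amulE comp_mul1 ?ell_comp1.
apply/eqP; rewrite eqEdim sub /= -/(hilbert F i.+1).
have [lei|gti] := leqP i (d - 3).
  rewrite hilbert_mid; last by lia.
  rewrite limg_dim_eq -/(hilbert F i) ?hilbert_mid //; first by lia.
  apply/eqP; rewrite -subv0; apply/subvP => a.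
  rewrite memv_cap memv_ker amulE => /andP[ha /eqP h0].
  by rewrite (l_inj _ ha h0) ?mem0v //; lia.
have -> : i.+1 = (d - (d - i.+1))%N by lia.
have -> : hilbert F (d - (d - i.+1)) = \dim (\1 @: Ac (d - i.+1)).
  rewrite lim1g -/(hilbert F (d - i.+1)) hilbert_top; last by lia.
  rewrite hilbF /=; have : (d - i.+1 < 2)%N by lia.
  by case: (d - i.+1)%N => [|[]].
apply: pair_dim => a ha h; rewrite id_lfunE.
apply: (l_inj01 _ ha); first by lia.
apply: (socle_form_nondeg charK homF (comp_mul1 ell_comp1 ha)); first by lia.
rewrite (_ : d - (d - i.+1).+1 = i)%N; last by lia.
move=> c hc; rewrite (mulrC l) -mulrA; apply: h.
by apply/memv_imgP; exists c; rewrite ?amulE.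
Qed.

Lemma l_weak_lefschetz : weak_lefschetz l.
Proof.
split=> [|i]; first exact: ell_comp1.
have [lti|gei] := ltnP i 2.
  left=> a c ha hc e; apply/eqP; rewrite -subr_eq0; apply/eqP.
  apply: (l_inj01 lti); first by rewrite rpredB.
  by rewrite mulrBr e subrr.
right=> c hc; have [ltid|gti] := ltnP i d.
  move: hc; rewrite -l_surj ?gei // => /memv_imgP[a ha ->].
  by exists a; rewrite ?amulE.
by exists 0; rewrite ?mem0v // mulr0 (comp_gt homF _ hc).
Qed.

(** l^(d-2) maps [N], of dimension 3, into N A_{d-2} = Z_{d-1}, of dimension 5 - 3 = 2. The kernel
    vector will head a string of length d - 2. *)
Lemma exists_kappa : exists k : A, [/\ k \in Ac 1, k != 0 & l ^+ (d - 2) * k = 0].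
Proof.
pose g := amul (l ^+ (d - 2)).
have subg : (g @: N <= NA (d - 2))%VS.
  apply/subvP => _ /memv_imgP[n hn ->]; rewrite amulE mulrC NA_mem //.
  exact: comp_exp ell_comp1.
have hd1 : (0 < d - 1 < d)%N by lia.
have := dimvS subg; have := limg_ker_dim theta (Ac (d - 1)).
have [-> ->] := theta_dim hd1.
rewrite -/(hilbert F _) (@hilbert_top 1) //= (_ : (d - 1).-1 = d - 2)%N; last by lia.
move=> e1 e2; have := limg_ker_dim g N; rewrite dim_N => e3.
have : (N :&: lker g)%VS != 0%VS.
  rewrite -dimv_eq0; move: e1 e2 e3; rewrite (_ : minn (d - 1).+1 3 = 3)%N; last by lia.
  move: (\dim (NA _)) (\dim (g @: _)) (\dim (_ :&: _)); lia.
rewrite -vpick0 => nz; exists (vpick (N :&: lker g)).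
have := memv_pick (N :&: lker g); rewrite memv_cap memv_ker amulE.
by case/andP => /(N_comp1 span_e) h /eqP h'.
Qed.

End NonRoot.

(** * Jordan bases built from prescribed string heads *)

Section JordanTypes.
Variables (l e : A).
Hypotheses (hl : l \in Ac 1) (he : e \in Ac 1).
Hypothesis (l_inj1 : forall a, a \in Ac 1 -> l * a = 0 -> a = 0).
Hypothesis (l_onto : forall i, (2 <= i < d)%N -> (amul l @: Ac i)%VS = Ac i.+1).
Hypothesis (le0 : l ^+ (d - 1) * e != 0).

Lemma iter_mul i (a : A) : iter i ( *%R l) a = l ^+ i * a.
Proof. exact: iter_mulr. Qed.

Lemma exp_top i a : (i <= d)%N -> a \in Ac (d - i) -> l ^+ i * a \in Ac d.
Proof.
by move=> lei ha; have := comp_mul (comp_exp i hl) ha; rewrite subnKC.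
Qed.

(** The span of the strings is stable under [l]. It contains A_0, A_1 and A_2 by the conditions on
    the heads, and the later degrees because [l] is onto there; the lengths add up to the dimension
    6d - 6. *)
Lemma jordan_basis_of_heads (zs : seq (A * nat)) :
  {in zs, forall s, 0 < s.2}%N -> {in zs, forall s, l ^+ s.2 * s.1 = 0} ->
  sumn (unzip2 zs) = (6 * d - 6)%N -> 1 \in unzip1 zs ->
  (Ac 1 <= <<l :: unzip1 zs>>)%VS ->
  (Ac 2 <= amul l @: Ac 1 + <<unzip1 zs>>)%VS ->
  jordan_basis ( *%R l) zs.
Proof.
move=> hpos h0 hsum h1 hA1 hA2.
have fg : amul l =1 *%R l by move=> a; rewrite amulE.
have h0' : {in zs, forall s, iter s.2 ( *%R l) s.1 = 0}.
  by move=> s hs; rewrite iter_mul h0.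
apply: jordan_basis_span => //; last first.
  by rewrite hsum (dim_apolar charK homF) sum_hilbert.
have := strings_stable fg h0'.
have heads s : s \in zs -> s.1 \in <<flatten [seq traject ( *%R l) z.1 z.2 | z <- zs]>>%VS.
  by move=> hs; apply: strings_head => //; apply: hpos.
move: (<<_>>%VS) heads => W heads stable.
have subh : (<<unzip1 zs>> <= W)%VS.
  by apply/span_subvP => _ /mapP[s hs ->]; apply: heads.
have W1 : 1 \in W by apply: (subvP subh); apply: memv_span.
have Wl : l \in W.
  by rewrite -[l]mulr1 -amulE (subvP stable) // memv_img.
have WA i : (Ac i <= W)%VS.
  elim: i => [|[|[|i]] IH].
  - by apply/subvP => _ /comp0_scalar[c ->]; apply: rpredZ.
  - apply: subv_trans hA1 _; rewrite span_cons subv_add subh andbT.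
    by apply/subvP => _ /vlineP[c ->]; apply: rpredZ.
  - apply: subv_trans hA2 _; rewrite subv_add subh andbT.
    exact: subv_trans (limgS _ IH) stable.
  - have [lti|] := ltnP i.+2 d; last first.
      by move=> gei; rewrite (comp_le_d homF) // sub0v.
    by rewrite -l_onto //; apply: subv_trans (limgS _ IH) stable.
by rewrite -(comp_sum_full homF); apply/subv_sumP.
Qed.

(** A hyperplane of A_1, since A_d is a line and [e] is not in it. The heads of degree 1 of strings
    of length at most d - 1 are taken here. *)
Definition hyper : {vspace A} := (Ac 1 :&: lker (amul (l ^+ (d - 1))))%VS.

Lemma mem_hyper a : (a \in hyper) = (a \in Ac 1) && (l ^+ (d - 1) * a == 0).
Proof. by rewrite memv_cap memv_ker amulE. Qed.

Lemma comp1_hyper a : a \in Ac 1 -> l ^+ (d - 1) * a != 0 ->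
  (Ac 1 <= hyper + <[a]>)%VS.
Proof.
have top b : b \in Ac 1 -> l ^+ (d - 1) * b \in Ac d.
  by move=> hb; apply: exp_top; [lia | rewrite subKn //; lia].
move=> ha la; apply/subvP => b hb; have [c bE] := socle_prop (top b hb) (top a ha) la.
rewrite -(subrK (c *: a) b); apply: memv_add; last by rewrite rpredZ ?memv_line.
by rewrite mem_hyper rpredB ?rpredZ //= mulrBr -apolar_scalerAr bE subrr.
Qed.

Lemma dim_hyper : \dim hyper = 4%N.
Proof.
have d5 : \dim (Ac 1) = 5%N by rewrite -[LHS]/(hilbert F 1) hilbF.
have := dimvS (comp1_hyper he le0); rewrite d5 => le5.
have := (dimv_add_leqif hyper <[e]>%VS).1; rewrite dim_vline => le1.
have : (\dim hyper < \dim (Ac 1))%N.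
  rewrite (ltn_leqif (dimv_leqif_sup (capvSl _ _))).
  apply: contra le0 => /subvP/(_ e he); rewrite memv_cap memv_ker amulE.
  by case/andP.
have := leq_trans le5 le1; rewrite d5; move: (\dim hyper).
by case: (e != 0) => h /=; lia.
Qed.

(** l A_1 has dimension 5 in A_2, of dimension 6. A vector outside it is corrected by a multiple of
    [l * e], whose image under l^(d-2) spans the line A_d. *)
Lemma exists_new : exists w : A,
  l ^+ (d - 2) * w = 0 /\ (Ac 2 <= amul l @: Ac 1 + <[w]>)%VS.
Proof.
have d5 : \dim (amul l @: Ac 1) = 5%N.
  rewrite limg_dim_eq -/(hilbert F 1) ?hilbF //; apply/eqP; rewrite -subv0.
  apply/subvP => a; rewrite memv_cap memv_ker amulE => /andP[ha /eqP h0].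
  by rewrite (l_inj1 ha h0) mem0v.
have d6 : \dim (Ac 2) = 6%N.
  by rewrite -/(hilbert F 2) hilbert_mid //; lia.
have sub2 : (amul l @: Ac 1 <= Ac 2)%VS.
  by apply/subvP => _ /memv_imgP[a ha ->]; rewrite amulE comp_mul1.
have : ~~ (Ac 2 <= amul l @: Ac 1)%VS.
  by apply/negP => /dimvS; rewrite d5 d6.
case/subvPn => w0 hw0 nw0.
have top a : a \in Ac 2 -> l ^+ (d - 2) * a \in Ac d.
  by move=> ha; apply: (@exp_top (d - 2)); rewrite ?leq_subr // subKn //; lia.
have e1 : l ^+ (d - 2) * (l * e) = l ^+ (d - 1) * e.
  by rewrite mulrA -exprSr; congr (l ^+ _ * _); lia.
have [|c cE] := socle_prop (top _ hw0) (top _ (comp_mul1 hl he)).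
  by rewrite e1.
pose w := w0 - c *: (l * e).
have hle : l * e \in (amul l @: Ac 1)%VS by rewrite -amulE memv_img.
have nw : w \notin (amul l @: Ac 1)%VS.
  apply: contra nw0 => hw; rewrite -(subrK (c *: (l * e)) w0).
  by rewrite rpredD // rpredZ.
exists w; split; first by rewrite mulrBr -apolar_scalerAr cE subrr.
have sub : (amul l @: Ac 1 + <[w]> <= Ac 2)%VS.
  rewrite subv_add sub2; apply/subvP => _ /vlineP[c' ->].
  by rewrite rpredZ // rpredB // rpredZ // (subvP sub2).
have : (\dim (amul l @: Ac 1) < \dim (amul l @: Ac 1 + <[w]>))%N.
  rewrite (ltn_leqif (dimv_leqif_sup (addvSl _ _))).
  apply: contra nw => /subvP; apply; apply: (subvP (addvSr _ _)).
  exact: memv_line.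
rewrite d5 -(dimv_leqif_sup sub).2 eqn_leq dimvS //= => lt6.
by rewrite d6.
Qed.

Lemma unzip_const (s : seq A) (k : nat) :
  (unzip1 [seq (c, k) | c <- s] = s) * (unzip2 [seq (c, k) | c <- s] = nseq (size s) k).
Proof. by split; elim: s => //= c s ->. Qed.

Lemma complement_basis (U W : {vspace A}) : (U <= W)%VS ->
  exists C : seq A, [/\ size C = (\dim W - \dim U)%N, {subset C <= W} &
                       (W <= <<C>> + U)%VS].
Proof.
move=> sUW; exists (vbasis (W :\: U)); split.
- by rewrite size_tuple -(dimv_cap_compl W U) (capv_idPr sUW) addKn.
- by move=> c /vbasis_mem; apply/subvP/diffvSl.
- rewrite (span_basis (vbasisP _)) -{1}(addv_diff_cap W U).
  by apply: addvS => //; apply: capvSr.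
Qed.

Variable k : A.
Hypotheses (hk : k \in Ac 1) (k_neq0 : k != 0) (lk : l ^+ (d - 2) * k = 0).

Lemma k_hyper : k \in hyper.
Proof.
rewrite mem_hyper hk (_ : d - 1 = (d - 2).+1)%N; last by lia.
by rewrite exprS -mulrA lk mulr0 eqxx.
Qed.

Lemma degree_facts :
  [/\ (0 < d - 1)%N, (0 < d - 2)%N, (0 < d)%N & ((d - 1).+1 = d)%N].
Proof. by split; lia. Qed.

(** The heads are 1, three vectors completing [k] to a generating set of [hyper], then [k], and the
    new vector [w] of degree 2. As l^d is nonzero, [l] itself supplies the direction of A_1 missing
    from [hyper]. *)
Lemma jordan_type_long : l ^+ d != 0 ->
  jordan_type ( *%R l) ([:: d.+1] ++ nseq 3 (d - 1)%N ++ nseq 2 (d - 2)%N).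
Proof.
move=> ld; split; first by rewrite /= /geq /=; lia.
have [d1 d2 d0 dS] := degree_facts.
have sumE : sumn ([:: d.+1] ++ nseq 3 (d - 1)%N ++ nseq 2 (d - 2)%N) = (6 * d - 6)%N.
  by rewrite /=; lia.
have [w [lw hA2]] := exists_new.
have sk : (<[k]> <= hyper)%VS by rewrite -memvE k_hyper.
have [C []] := complement_basis sk; rewrite dim_hyper dim_vline k_neq0 /=.
move=> sizeC memC spanC.
have memH c : c \in C -> l ^+ (d - 1) * c = 0.
  by move=> /memC; rewrite mem_hyper => /andP[_ /eqP].
pose zs := (1, d.+1) :: [seq (c, (d - 1)%N) | c <- C] ++ [:: (k, (d - 2)%N); (w, (d - 2)%N)].
have zs2 : unzip2 zs = [:: d.+1] ++ nseq 3 (d - 1)%N ++ nseq 2 (d - 2)%N.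
  by rewrite /zs /= /unzip2 map_cat -/unzip2 -/(unzip2 _) unzip_const sizeC.
have zs1 : unzip1 zs = 1 :: C ++ [:: k; w].
  by rewrite /zs /= /unzip1 map_cat -/(unzip1 _) unzip_const.
exists zs => //; apply: jordan_basis_of_heads.
- move=> s; rewrite inE mem_cat !inE => /orP[/eqP-> //|/orP[/mapP[c _ ->] //|]].
  by case/orP => /eqP ->.
- move=> s; rewrite inE mem_cat !inE.
  case/orP => [/eqP->|/orP[/mapP[c hc ->]|/orP[]/eqP->]] /=.
  + by rewrite mulr1 (comp_gt homF _ (comp_exp d.+1 hl)).
  + exact: memH.
  + exact: lk.
  + exact: lw.
- by rewrite zs2.
- by rewrite zs1 inE eqxx.
- have l1 : l ^+ (d - 1) * l != 0.
    by rewrite -exprSr dS.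
  apply: subv_trans (comp1_hyper hl l1) _; rewrite zs1.
  rewrite subv_add -memvE memv_span ?inE ?eqxx // andbT.
  apply: subv_trans spanC _; rewrite subv_add -memvE memv_span ?andbT.
    by apply: sub_span => c hc; rewrite !inE mem_cat hc !orbT.
  by rewrite !inE mem_cat !inE eqxx !orbT.
- apply: subv_trans hA2 _; apply: addvS => //; rewrite -memvE memv_span // zs1.
  by rewrite !inE mem_cat !inE eqxx !orbT.
Qed.

(** Now [l] lies in [hyper], where it belongs to the string of 1, so only two heads of length d - 1
    are needed besides [k]; the direction outside [hyper] is supplied by [e], with a string of
    length [d]. *)
Lemma jordan_type_short : l ^+ (d - 1) != 0 -> l ^+ d = 0 ->
  jordan_type ( *%R l) (nseq 2 d ++ nseq 2 (d - 1)%N ++ nseq 2 (d - 2)%N).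
Proof.
move=> ld1 ld; split; first by rewrite /= /geq /=; lia.
have [d1 d2 d0 dS] := degree_facts.
have sumE : sumn (nseq 2 d ++ nseq 2 (d - 1)%N ++ nseq 2 (d - 2)%N) = (6 * d - 6)%N.
  by rewrite /=; lia.
have [w [lw hA2]] := exists_new.
have lE : l ^+ (d - 1) * l = 0.
  by rewrite -exprSr dS.
have l_hyper : l \in hyper by rewrite mem_hyper hl lE eqxx.
have sk : (<[k]> + <[l]> <= hyper)%VS by rewrite subv_add -!memvE k_hyper.
(* [k] and [l] are independent because l^(d-2) kills [k] but not [l]. *)
have dkl : \dim (<[k]> + <[l]>) = 2%N.
  rewrite -(span_seq1 l) -span_cons; apply/eqP.
  suff : free [:: k; l] by [].
  rewrite free_cons span_seq1 seq1_free; apply/andP; split; last first.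
    by apply: contraNneq ld1 => ->; rewrite expr0n gtn_eqF.
  apply: contra ld1 => /vlineP[c kE]; have c0 : c != 0.
    by apply: contraNneq k_neq0 => c0; rewrite kE c0 scale0r.
  have : c *: l ^+ (d - 1) = 0.
    by rewrite -[RHS]lk kE -apolar_scalerAr -exprSr -subSn ?subSS // -ltnS -dS ltnS.
  by move/eqP; rewrite scaler_eq0 (negPf c0).
have [C []] := complement_basis sk; rewrite dim_hyper dkl /=.
move=> sizeC memC spanC.
have memH c : c \in C -> l ^+ (d - 1) * c = 0.
  by move=> /memC; rewrite mem_hyper => /andP[_ /eqP].
pose zs := [:: (1, d); (e, d)] ++ [seq (c, (d - 1)%N) | c <- C] ++
  [:: (k, (d - 2)%N); (w, (d - 2)%N)].
have zs2 : unzip2 zs = nseq 2 d ++ nseq 2 (d - 1)%N ++ nseq 2 (d - 2)%N.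
  by rewrite /zs /= /unzip2 map_cat -/unzip2 -/(unzip2 _) unzip_const sizeC.
have zs1 : unzip1 zs = [:: 1; e] ++ C ++ [:: k; w].
  by rewrite /zs /= /unzip1 map_cat -/(unzip1 _) unzip_const.
exists zs => //; apply: jordan_basis_of_heads.
- move=> s; rewrite !mem_cat !inE -!orbA.
  by case/or4P=> [/eqP->|/eqP->|/mapP[c _ ->]|/orP[]/eqP->].
- move=> s; rewrite !mem_cat !inE -!orbA.
  case/or4P=> [/eqP->|/eqP->|/mapP[c hc ->]|/orP[]/eqP->] /=.
  + by rewrite mulr1.
  + by rewrite ld mul0r.
  + exact: memH.
  + exact: lk.
  + exact: lw.
- by rewrite zs2.
- by rewrite zs1 inE eqxx.
- apply: subv_trans (comp1_hyper he le0) _; rewrite zs1.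
  rewrite subv_add -memvE memv_span ?inE ?eqxx ?orbT // andbT.
  apply: subv_trans spanC _; rewrite !subv_add -!memvE.
  rewrite [l \in _]memv_span ?inE ?eqxx // [k \in _]memv_span ?andbT.
    by apply: sub_span => c hc; rewrite !inE mem_cat hc !orbT.
  by rewrite !inE mem_cat !inE eqxx !orbT.
- apply: subv_trans hA2 _; apply: addvS => //; rewrite -memvE memv_span // zs1.
  by rewrite !inE mem_cat !inE eqxx !orbT.
Qed.

End JordanTypes.

(** * Existence of both Jordan types *)

Lemma expr_add_sq0 (a m : A) i : m * m = 0 ->
  (a + m) ^+ i.+1 = a ^+ i.+1 + (m * a ^+ i) *+ i.+1.
Proof.
move=> m0; elim: i => [|i IH]; first by rewrite !expr1 expr0 mulr1.
rewrite exprS IH -(mulr_natl (m * a ^+ i)) -(mulr_natl (m * a ^+ i.+1)).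
have -> : (a + m) * (a ^+ i.+1 + i.+1%:R * (m * a ^+ i)) =
    a ^+ i.+2 + i.+2%:R * (m * a ^+ i.+1) + m * m * (i.+1%:R * a ^+ i).
  by rewrite !exprS; ring.
by rewrite m0 mul0r addr0.
Qed.

Lemma weak_lefschetz_scale (c : K) (l : A) : c != 0 ->
  weak_lefschetz l -> weak_lefschetz (c *: l).
Proof.
move=> c0 [hl wl]; split=> [|i]; first by rewrite rpredZ.
case: (wl i) => [inj|sur]; [left | right].
  move=> a b ha hb; rewrite -!apolar_scalerAl => /(congr1 (fun w => c^-1 *: w)).
  by rewrite !scalerA mulVf // !scale1r; apply: inj.
move=> b /sur[a ha <-]; exists (c^-1 *: a); first by rewrite rpredZ.
by rewrite -apolar_scalerAl -apolar_scalerAr scalerA mulfV ?scale1r.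
Qed.

(** The contrapositive of [l_weak_lefschetz] after scaling the coefficient of [u] to 1. Multiples of
    [v], the case [c] = 0, correspond to a root at infinity and are treated separately. *)
Lemma weak_lefschetz_root (q : {poly K}) (c c' : K) (m : A) :
  (size q <= 4)%N -> theta (binform 3 q) = 0 -> m \in N -> c != 0 ->
  ~ weak_lefschetz (c *: u + c' *: v + m) -> q.[- (c' / c)] = 0.
Proof.
move=> sq hq hm c0 nwl; apply/eqP/contraT => qt; case: nwl.
have -> : c *: u + c' *: v + m = c *: (u - (- (c' / c)) *: v + c^-1 *: m).
  rewrite scaleNr opprK !scalerDr !scalerA mulfV // scale1r mulrCA mulfV //.
  by rewrite mulr1.
by apply: weak_lefschetz_scale => //; apply: (l_weak_lefschetz sq) => //; rewrite rpredZ.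
Qed.

Lemma jordan_types_occur :
  (exists2 l : A, weak_lefschetz l &
     jordan_type ( *%R l) ([:: d.+1] ++ nseq 3 (d - 1)%N ++ nseq 2 (d - 2)%N)) /\
  (exists2 l : A, weak_lefschetz l &
     jordan_type ( *%R l) (nseq 2 d ++ nseq 2 (d - 1)%N ++ nseq 2 (d - 2)%N)).
Proof.
have h3 : (0 < 3 < d)%N by lia.
have [b3 _] := theta_dim h3.
have le3 : (b 3 <= 3)%N by rewrite b3.
have [q [q0 sq hq]] := exists_relation le3.
have [t] := closed_nonrootP _ q0; rewrite rootE => qt.
have [n hn sn] := exists_dual sq qt hq.
have dS : ((d - 1).+1 = d)%N by lia.
(* Along the line spanned by [n], the value of [sigma] at the d-th power is an affine function of
   the coefficient, with slope [d%:R * s], so it takes every value [r]; the values 1 and 0 give the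
   two types. *)
have lin r : exists m, m \in N /\ sigma ((u - t *: v + m) ^+ d) = r.
  set l := u - t *: v; set s := sigma (n * l ^+ (d - 1)) in sn.
  have ds : d%:R * s != 0.
    rewrite mulf_neq0 // ((pcharf0P K).1 charK); lia.
  exists (((r - sigma (l ^+ d)) / (d%:R * s)) *: n); split; first by rewrite rpredZ.
  rewrite -dS expr_add_sq0 dS; last by apply: NN; rewrite rpredZ.
  rewrite linearD linearMn /= -apolar_scalerAl linearZ /= -/s.
  set c := _ / _; rewrite -mulr_natl (_ : c *: s = c * s) // mulrCA mulfVK //.
  by rewrite addrC subrK.
have facts m : m \in N ->
  [/\ weak_lefschetz (u - t *: v + m), (u - t *: v + m) ^+ (d - 1) * n != 0,
      (u - t *: v + m) ^+ (d - 1) != 0 & n \in Ac 1].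
  move=> hm; have ne : (u - t *: v + m) ^+ (d - 1) * n != 0.
    rewrite (expr_on_N _ _ NN hm hn) mulrC; apply: contra_neq sn => ->.
    by rewrite linear0.
  split=> //; first exact: (l_weak_lefschetz sq).
    by apply: contra_neq ne => ->; rewrite mul0r.
  exact: (N_comp1 span_e).
split.
- have [m [hm e]] := lin 1; have [wl ne _ hn1] := facts m hm.
  exists (u - t *: v + m) => //.
  have [k [hk k0 lk]] := exists_kappa sq qt hm.
  apply: (jordan_type_long (ell_comp1 t hm) hn1 _ _ ne hk k0 lk).
  + by move=> a; apply: (l_inj01 sq qt hq hm).
  + by move=> i; apply: (l_surj sq qt hq hm).
  + by apply: contra_eq_neq e => ->; rewrite linear0 eq_sym oner_neq0.
- have [m [hm e]] := lin 0; have [wl ne ne' hn1] := facts m hm.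
  exists (u - t *: v + m) => //.
  have [k [hk k0 lk]] := exists_kappa sq qt hm.
  apply: (jordan_type_short (ell_comp1 t hm) hn1 _ _ ne hk k0 lk) => //.
  + by move=> a; apply: (l_inj01 sq qt hq hm).
  + by move=> i; apply: (l_surj sq qt hq hm).
  + by apply: socle_form_eq0 => //; apply: comp_exp; apply: ell_comp1.
Qed.

End Lefschetz.

(** * Strings of the other linear forms *)

Section StringBounds.
Variables (d : nat) (K : fieldType) (F : {mpoly K[5]}).
Hypotheses (homF : F \is d.-homog) (d_ge5 : (5 <= d)%N).
Local Notation A := (apolar_alg F).
Local Notation Ac := (apolar_comp F).
Implicit Types (a b l : A) (zs : seq (A * nat)).

Definition power_descent l k :=
  forall a, l ^+ (d - 2) * a = 0 -> exists b, l ^+ k * a = l ^+ k.+1 * b.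

(** A head [z] of a string of length p' with k < p' < d - 1 satisfies the premise of
    [power_descent]. Multiplying its conclusion by l^(p'-1-k) puts the last vector of the string in
    the image of l^p', against [string_last]. *)
Lemma string_length_descent l k zs : jordan_basis ( *%R l) zs ->
  power_descent l k ->
  {in string_lengths zs, forall p, d - 1 <= p \/ p <= k}%N.
Proof.
move=> hzs desc p /mapP[[z p'] hz /= ->]; have [gep|ltp] := leqP (d - 1) p'.
  by left.
right; rewrite leqNgt; apply/negP => ltkp.
have fg : amul l =1 *%R l by move=> a; rewrite amulE.
have := string_last fg (w := _) hzs hz.
have [_ h0 _] := hzs; have := h0 _ hz; rewrite /= iter_mulr => lz.
have [|b e] := desc z.
  by rewrite -(subnK (_ : p' <= d - 2)%N) ?exprD -?mulrA ?lz ?mulr0 //; lia.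
move=> /(_ b); apply; rewrite !iter_mulr.
rewrite -(subnK (_ : k <= p'.-1)%N); last by lia.
by rewrite exprD -mulrA e mulrA -exprD addnS -addSn; congr (l ^+ _ * _); lia.
Qed.

Lemma string_length_nilp l k zs : jordan_basis ( *%R l) zs -> l ^+ k = 0 ->
  {in string_lengths zs, forall p, p <= k}%N.
Proof.
move=> hzs lk p /mapP[[z p'] hz /= ->]; rewrite leqNgt; apply/negP => ltkp.
have fg : amul l =1 *%R l by move=> a; rewrite amulE.
apply: (string_last fg (w := 0) hzs hz); rewrite !iter_mulr mulr0.
rewrite -(subnK (_ : k <= p'.-1)%N); last by lia.
by rewrite exprD lk mulr0 mul0r.
Qed.

Section Generators.
Variables (x y z u v : A).
Local Notation gens := [:: x; y; z; u; v].
Local Notation N := <<[:: x; y; z]>>%VS.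
Hypothesis (span_e : Ac 1 = <<gens>>%VS).
Hypothesis (NN : forall a b, a \in N -> b \in N -> a * b = 0).

(** The elements [b] with l^k b in l^(k+1) A form an ideal [W], which contains all degrees at least
    2 once it contains the products of generators. Split [a] into degrees 0, 1 and at least 2: since
    degrees above [d] vanish, testing with [e * e'] kills the constant part, and testing with the
    generators isolates the linear part. *)
Lemma descent_of_generators l k : l \in Ac 1 ->
  {in gens &, forall a b, exists c, l ^+ k * (a * b) = l ^+ k.+1 * c} ->
  (exists a b, [/\ a \in Ac 1, b \in Ac 1 & l ^+ (d - 2) * (a * b) != 0]) ->
  {in Ac 1, forall a, (forall b, b \in gens -> l ^+ (d - 2) * (b * a) = 0) ->
     l ^+ k * a = 0} ->
  power_descent l k.
Proof.
have ltd i : (d < d - 2 + (1 + (1 + i)).+1)%N by lia.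
have lt2 : (d < d - 2 + 1.+2)%N by lia.
have dE : (d.+1 = 1 + (1 + d.-1))%N by lia.
move=> hl hgen [e [e' [he he' ne]]] hA1 a la.
pose W := (amul (l ^+ k) @^-1: (amul (l ^+ k.+1) @: fullv))%VS.
have WP b : reflect (exists c, l ^+ k * b = l ^+ k.+1 * c) (b \in W).
  rewrite -memv_preim amulE; apply: (iffP memv_imgP) => [[c _ ->]|[c ->]].
    by exists c; rewrite amulE.
  by exists c; rewrite ?memvf // amulE.
have WM b c : c \in W -> b * c \in W.
  by move=> /WP[c' e1]; apply/WP; exists (b * c'); rewrite mulrCA e1 mulrCA.
have W2 : (Ac 2 <= W)%VS.
  apply: compS_sub => b c; rewrite span_e => hb hc.
  have : (<<gens>> <= amul c @^-1: W)%VS.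
    apply/span_subvP => b' hb'; rewrite -memv_preim amulE mulrC.
    have : (<<gens>> <= amul b' @^-1: W)%VS.
      apply/span_subvP => c' hc'; rewrite -memv_preim amulE; apply/WP.
      exact: hgen.
    by move=> /subvP/(_ c hc); rewrite -memv_preim amulE.
  by move=> /subvP/(_ b hb); rewrite -memv_preim amulE mulrC.
have WA i : (2 <= i)%N -> (Ac i <= W)%VS.
  elim: i => [|[|[|i]] IH] // _; apply: compS_sub => b c _ hc.
  by apply: WM; apply: (subvP (IH _)).
have [a0 [a1 [r [ha0 ha1 [hr lr aE]]]]] : exists a0 a1 r, [/\ a0 \in Ac 0,
    a1 \in Ac 1 & [/\ r \in W, forall b, b \in Ac 1 -> l ^+ (d - 2) * (b * r) = 0 &
    a = a0 + (a1 + r)]].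
  have := memvf a; rewrite -(comp_sum_full homF).
  (* Indices 0 and 1 are split off; the remaining summands have degree [1 + (1 + i)], at least 2. *)
  rewrite dE !big_split_ord /= !big_ord1 => /memv_addP[a0 ha0 [b /memv_addP[a1 ha1 [r hr ->]] ->]].
  exists a0, a1, r; split=> //; split=> //.
    by apply: subvP hr; apply/subv_sumP => i _; apply: WA.
  move=> b' hb; have : (\sum_(i < d.-1) Ac (1 + (1 + i)) <= lker (amul (l ^+ (d - 2) * b')))%VS.
    apply/subv_sumP => i _; apply/subvP => c hc; rewrite memv_ker amulE -mulrA.
    apply/eqP; apply: (comp_gt homF) (comp_mul (comp_exp _ hl) (comp_mul1 hb hc)).
    exact: ltd.
  by move=> /subvP/(_ r hr); rewrite memv_ker amulE -mulrA => /eqP.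
have lt1 b c b' : b \in Ac 1 -> c \in Ac 1 -> b' \in Ac 1 -> l ^+ (d - 2) * (b * (c * b')) = 0.
  move=> hb hc hb'; apply: (comp_gt homF) (comp_mul (comp_exp (d - 2) hl) (comp_mul1 hb (comp_mul1 hc hb'))).
  exact: lt2.
have a00 : a0 = 0.
  have [c cE] := comp0_scalar ha0.
  have : l ^+ (d - 2) * (e * e' * a) = 0 by rewrite mulrCA la mulr0.
  have -> : l ^+ (d - 2) * (e * e' * a) = l ^+ (d - 2) * (e * e') * a0 +
      l ^+ (d - 2) * (e * (e' * a1)) + e' * (l ^+ (d - 2) * (e * r)).
    by rewrite aE; ring.
  rewrite lt1 // lr // mulr0 !addr0 cE -apolar_scalerAr mulr1 => /eqP.
  by rewrite scaler_eq0 (negPf ne) orbF => /eqP ->; rewrite scale0r.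
have la1 b : b \in gens -> l ^+ (d - 2) * (b * a1) = 0.
  move=> /(gen_comp1 span_e) hb; have : l ^+ (d - 2) * (b * a) = 0 by rewrite mulrCA la mulr0.
  by rewrite aE a00 add0r !mulrDr lr // addr0.
have [c cE] := WP _ hr; exists c.
by rewrite aE a00 add0r mulrDr hA1 // add0r cE.
Qed.

(** The 25 products reduce to nine by commutativity and N^2 = 0. *)
Lemma gens_products (P : A -> Prop) :
  P 0 -> P (x * u) -> P (x * v) -> P (y * u) -> P (y * v) -> P (z * u) ->
  P (z * v) -> P (u * u) -> P (u * v) -> P (v * v) ->
  {in gens &, forall a b, P (a * b)}.
Proof.
move=> P0 xu xv yu yv zu zv uu uv vv.
have PN a b : a \in [:: x; y; z] -> b \in [:: x; y; z] -> P (a * b).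
  by move=> ha hb; rewrite NN // memv_span.
have hx : x \in [:: x; y; z] by rewrite inE eqxx.
have hy : y \in [:: x; y; z] by rewrite !inE eqxx orbT.
have hz : z \in [:: x; y; z] by rewrite !inE eqxx !orbT.
move=> a b; rewrite !inE.
by case/or4P=> [/eqP->|/eqP->|/eqP->|/orP[]/eqP->];
  case/or4P=> [/eqP->|/eqP->|/eqP->|/orP[]/eqP->]; auto; rewrite mulrC; auto.
Qed.

Section TwoTerms.
Variable m : A.
Hypothesis hm : m \in N.

Lemma x_in_N : x \in N. Proof. by rewrite memv_span // inE eqxx. Qed.
Lemma y_in_N : y \in N. Proof. by rewrite memv_span // !inE eqxx orbT. Qed.
Lemma z_in_N : z \in N. Proof. by rewrite memv_span // !inE eqxx !orbT. Qed.
Lemma m_sq0 : m * m = 0. Proof. exact: NN. Qed.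

Lemma expr_d1 a : a ^+ (d - 1) = a ^+ (d - 2) * a.
Proof. by rewrite -exprSr; congr (_ ^+ _); lia. Qed.

Lemma descent_zero : power_descent m 2.
Proof. by move=> a _; exists 0; rewrite expr2 m_sq0 mul0r mulr0. Qed.

(* The cubic relation is u v (v - g u) = 0, and l has the simple factor u. *)
Lemma descent_distinct (g : K) : g != 0 ->
  x * u = 0 -> y * v = 0 -> z * v = g *: (z * u) ->
  u * v * v = g *: (u * u * v) ->
  u ^+ (d - 1) * y != 0 -> u ^+ (d - 1) * z != 0 -> power_descent (u + m) 2.
Proof.
move=> g0 xu yv zv uvv uy uz; set l : A := u + m.
have hu : u \in Ac 1 by apply: (gen_comp1 span_e); rewrite !inE eqxx !orbT.
have hl : l \in Ac 1 by rewrite rpredD // (N_comp1 span_e).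
have uE := expr_d1 u; have m2 := m_sq0; have lN n i : n \in N -> l ^+ i * n = u ^+ i * n.
  move=> hn; exact: (expr_on_N _ _ NN hm hn).
(* Since v acts on [N] through [u] after one multiplication by [u], the mixed terms with [m * v] can
   be absorbed into a higher power of [l]. *)
have [w hw umv] : exists2 w, w \in N & u * m * v = u * u * w.
  have [c1 [c2 [c3 mE]]] := spanN hm; exists ((c3 * g) *: z); first by rewrite rpredZ ?z_in_N.
  rewrite mE !mulrDr !mulrDl -!apolar_scalerAr -!apolar_scalerAl -!mulrA.
  rewrite yv zv -!apolar_scalerAr [u * (x * v)]mulrA [u * x]mulrC xu !mul0r mulr0 !scaler0.
  by rewrite !add0r scalerA mulrA mulrAC -mulrA.
(* The scalar becomes an element of [A], so that [ring] can treat it. *)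
pose G : A := g *: (1 : A); have gE a : g *: a = G * a by rewrite -apolar_scalerAl mul1r.
rewrite !gE in zv uvv.
apply: descent_of_generators => //.
- apply: (gens_products (P := fun w => exists c, l ^+ 2 * w = l ^+ 3 * c)).
  + by exists 0; rewrite !mulr0.
  + by exists 0; rewrite xu !mulr0.
  + exists 0; rewrite mulrA lN ?x_in_N // expr2 -mulrA -mulrA [u * (x * v)]mulrA.
    by rewrite [u * x]mulrC xu mul0r !mulr0.
  + exists y; rewrite mulrA !lN ?y_in_N //; ring.
  + by exists 0; rewrite yv !mulr0.
  + exists z; rewrite mulrA !lN ?z_in_N //; ring.
  + exists (G * z); rewrite zv.
    have -> : l ^+ 2 * (G * (z * u)) = G * (l ^+ 2 * z) * u by ring.
    have -> : l ^+ 3 * (G * z) = G * (l ^+ 3 * z) by ring.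
    rewrite !lN ?z_in_N //; ring.
  + exists (u - m); have -> : l ^+ 2 * (u * u) = l ^+ 3 * (u - m) + l ^+ 2 * (m * m).
      by rewrite /l; ring.
    by rewrite m2 mulr0 addr0.
  + exists (v - w); have -> : l ^+ 2 * (u * v) = l ^+ 3 * v - l ^+ 2 * m * v.
      by rewrite /l; ring.
    rewrite mulrBr (lN _ _ hw) (lN _ _ hm); congr (_ - _).
    have -> : u ^+ 2 * m * v = u * (u * m * v) by ring.
    by rewrite umv; ring.
  (* The cubic relation trades u v^2 for g u^2 v, so the witness found for [u * v] works after
     scaling by [g]. *)
  + exists (G * (v - w)).
    have -> : l ^+ 3 * (G * (v - w)) = G * (u ^+ 3 * v + 3%:R * (u * (u * m * v))
        + m * m * ((3%:R * u + m) * v)) - G * (l ^+ 3 * w) by rewrite /l; ring.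
    have -> : l ^+ 2 * (v * v) = u * (u * v * v) + 2%:R * m * (u * v * v) + m * m * (v * v).
      by rewrite /l; ring.
    rewrite m2 !mul0r !addr0 uvv (lN _ _ hw).
    have -> : u ^+ 3 * w = u * (u * u * w) by ring.
    by rewrite -umv; ring.
- exists u, y; split; [exact: hu | exact: (N_comp1 span_e y_in_N) | ].
  rewrite [u * y]mulrC mulrA (lN _ _ y_in_N) mulrAC -uE; exact: uy.
(* Testing with [y] and [z] removes [u] and [v] from the linear element; testing with [v] and [u]
   then removes [z] and [y]. What is left is a multiple of [x], which [u] kills. *)
- move=> _ /(comp1_coords span_e)[n [c [c' [hn ->]]]] h.
  have hk b : b \in N -> b \in gens -> c *: (u ^+ (d - 1) * b) +
      c' *: (u ^+ (d - 2) * (b * v)) = 0.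
    move=> hb hg; rewrite -[RHS](h b hg) (mulrA (l ^+ _) b) (lN _ _ hb) -mulrA.
    rewrite !mulrDr (NN hb hn) mulr0 add0r -!apolar_scalerAr.
    by rewrite uE -[_ * u * b]mulrA [u * b]mulrC.
  have c0 : c = 0.
    have := hk y y_in_N; rewrite !inE eqxx orbT => /(_ isT).
    rewrite yv mulr0 scaler0 addr0 => /eqP.
    by rewrite scaler_eq0 (negPf uy) orbF => /eqP.
  have c'0 : c' = 0.
    have := hk z z_in_N; rewrite !inE eqxx !orbT => /(_ isT).
    rewrite c0 scale0r add0r zv mulrCA -gE scalerA [z * u]mulrC mulrA -uE => /eqP.
    by rewrite scaler_eq0 (negPf uz) orbF mulf_eq0 (negPf g0) orbF => /eqP.
  have [c1 [c2 [c3 nE]]] := spanN hn.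
  rewrite c0 c'0 !scale0r !addr0 in h *.
  have uz0 : u ^+ (d - 2) * (u * n) = c2 *: (u ^+ (d - 1) * y) + c3 *: (u ^+ (d - 1) * z).
    rewrite nE !mulrDr -!apolar_scalerAr [u * x]mulrC xu mulr0 scaler0 add0r.
    by rewrite !mulrA -!uE.
  have vz0 : u ^+ (d - 2) * (v * n) = (c3 * g) *: (u ^+ (d - 1) * z).
    rewrite nE !mulrDr -!apolar_scalerAr [v * y]mulrC yv [v * z]mulrC zv -gE.
    rewrite [z * u]mulrC -!apolar_scalerAr scalerA (mulrA _ u z) -uE mulr0 scaler0 addr0.
    rewrite -[RHS]add0r; congr (_ + _).
    have -> : (d - 2 = (d - 3).+1)%N by lia.
    by rewrite exprSr [v * x]mulrC -mulrA [u * _]mulrA [u * x]mulrC xu mul0r mulr0 scaler0.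
  have c30 : c3 = 0.
    have := h v; rewrite !inE eqxx !orbT => /(_ isT).
    rewrite mulrCA (lN _ _ hn) mulrCA vz0 => /eqP.
    by rewrite scaler_eq0 (negPf uz) orbF mulf_eq0 (negPf g0) orbF => /eqP.
  have c20 : c2 = 0.
    have := h u; rewrite !inE eqxx !orbT => /(_ isT).
    rewrite mulrCA (lN _ _ hn) mulrCA uz0 c30 scale0r addr0 => /eqP.
    by rewrite scaler_eq0 (negPf uy) orbF => /eqP.
  rewrite lN // nE c20 c30 !scale0r !addr0 -apolar_scalerAr expr2 -mulrA [u * x]mulrC xu.
  by rewrite mulr0 scaler0.
Qed.

(* The cubic relation is u v^2 = 0, and l has the simple factor u. *)
Lemma descent_simple (g : K) : g != 0 ->
  x * v = 0 -> z * u = 0 -> y * v = g *: (x * u) -> u * v * v = 0 ->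
  u ^+ (d - 1) * x != 0 -> power_descent (u + m) 2.
Proof.
move=> g0 xv zu yv uvv ux; set l : A := u + m.
have hu : u \in Ac 1 by apply: (gen_comp1 span_e); rewrite !inE eqxx !orbT.
have hl : l \in Ac 1 by rewrite rpredD // (N_comp1 span_e).
have uE := expr_d1 u; have m2 := m_sq0.
have lN n i : n \in N -> l ^+ i * n = u ^+ i * n by move=> hn; exact: (expr_on_N _ _ NN hm hn).
have uz i : u ^+ i.+1 * z = 0 by rewrite exprSr -mulrA [u * z]mulrC zu mulr0.
pose G : A := g *: (1 : A); have gE a : g *: a = G * a by rewrite -apolar_scalerAl mul1r.
rewrite gE in yv.
have [w hw umv] : exists2 w, w \in N & u * m * v = u * u * w.
  have [c1 [c2 [c3 mE]]] := spanN hm; exists ((c2 * g) *: x); first by rewrite rpredZ ?x_in_N.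
  have -> : u * m * v = c1 *: (u * (x * v)) + c2 *: (u * (y * v)) + c3 *: (z * u * v).
    rewrite mE !mulrDr !mulrDl -!apolar_scalerAr -!apolar_scalerAl -!mulrA.
    by rewrite [u * (z * v)]mulrCA.
  rewrite xv zu yv mul0r mulr0 !scaler0 addr0 add0r -gE -!apolar_scalerAr scalerA.
  by rewrite [x * u]mulrC mulrA.
apply: descent_of_generators => //.
- apply: (gens_products (P := fun w => exists c, l ^+ 2 * w = l ^+ 3 * c)).
  + by exists 0; rewrite !mulr0.
  + exists x; rewrite mulrA !lN ?x_in_N //; ring.
  + by exists 0; rewrite xv !mulr0.
  + exists y; rewrite mulrA !lN ?y_in_N //; ring.
  + exists (G * x); rewrite yv.
    have -> : l ^+ 2 * (G * (x * u)) = G * (l ^+ 2 * x) * u by ring.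
    have -> : l ^+ 3 * (G * x) = G * (l ^+ 3 * x) by ring.
    rewrite !lN ?x_in_N //; ring.
  + by exists 0; rewrite zu !mulr0.
  + by exists 0; rewrite mulrA lN ?z_in_N // uz mul0r mulr0.
  + exists (u - m); have -> : l ^+ 2 * (u * u) = l ^+ 3 * (u - m) + l ^+ 2 * (m * m).
      by rewrite /l; ring.
    by rewrite m2 mulr0 addr0.
  + exists (v - w); have -> : l ^+ 2 * (u * v) = l ^+ 3 * v - l ^+ 2 * m * v.
      by rewrite /l; ring.
    rewrite mulrBr (lN _ _ hw) (lN _ _ hm); congr (_ - _).
    have -> : u ^+ 2 * m * v = u * (u * m * v) by ring.
    by rewrite umv; ring.
  + exists 0; rewrite mulr0.
    have -> : l ^+ 2 * (v * v) = (u + 2%:R * m) * (u * v * v) + m * m * (v * v).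
      by rewrite /l; ring.
    by rewrite m2 uvv mul0r mulr0 addr0.
- exists u, x; split; [exact: hu | exact: (N_comp1 span_e x_in_N) | ].
  rewrite [u * x]mulrC mulrA (lN _ _ x_in_N) mulrAC -uE; exact: ux.
(* The tests with [x], [y], [v] and [u] remove in turn [u], [v], [y] and [x], leaving a multiple of
   [z], which [u] kills. *)
- move=> _ /(comp1_coords span_e)[n [c [c' [hn ->]]]] h.
  have hk b : b \in N -> b \in gens -> c *: (u ^+ (d - 1) * b) +
      c' *: (u ^+ (d - 2) * (b * v)) = 0.
    move=> hb hg; rewrite -[RHS](h b hg) (mulrA (l ^+ _) b) (lN _ _ hb) -mulrA.
    rewrite !mulrDr (NN hb hn) mulr0 add0r -!apolar_scalerAr.
    by rewrite uE -[_ * u * b]mulrA [u * b]mulrC.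
  have c0 : c = 0.
    have := hk x x_in_N; rewrite !inE eqxx => /(_ isT).
    rewrite xv mulr0 scaler0 addr0 => /eqP.
    by rewrite scaler_eq0 (negPf ux) orbF => /eqP.
  have uyv : u ^+ (d - 2) * (y * v) = g *: (u ^+ (d - 1) * x).
    by rewrite yv -gE -apolar_scalerAr uE -mulrA [u * x]mulrC.
  have c'0 : c' = 0.
    have := hk y y_in_N; rewrite !inE eqxx !orbT => /(_ isT).
    rewrite c0 scale0r add0r uyv scalerA => /eqP.
    by rewrite scaler_eq0 (negPf ux) orbF mulf_eq0 (negPf g0) orbF => /eqP.
  have [c1 [c2 [c3 nE]]] := spanN hn.
  rewrite c0 c'0 !scale0r !addr0 in h *.
  have c20 : c2 = 0.
    have := h v; rewrite !inE eqxx !orbT => /(_ isT).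
    rewrite mulrCA (lN _ _ hn) mulrCA nE !mulrDr -!apolar_scalerAr.
    rewrite [v * x]mulrC xv [v * y]mulrC uyv [v * z]mulrC mulrA.
    have -> : (d - 2 = (d - 3).+1)%N by lia.
    rewrite uz mul0r mulr0 !scaler0 addr0 add0r scalerA => /eqP.
    by rewrite scaler_eq0 (negPf ux) orbF mulf_eq0 (negPf g0) orbF => /eqP.
  have c10 : c1 = 0.
    have := h u; rewrite !inE eqxx !orbT => /(_ isT).
    rewrite mulrCA (lN _ _ hn) mulrCA nE c20 scale0r addr0 mulrDr -!apolar_scalerAr.
    rewrite mulrDr -!apolar_scalerAr [u * z]mulrC zu mulr0 scaler0 addr0 mulrA -uE => /eqP.
    by rewrite scaler_eq0 (negPf ux) orbF => /eqP.
  by rewrite (lN _ _ hn) nE c20 c10 !scale0r !add0r -apolar_scalerAr uz scaler0.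
Qed.

(* The cubic relation is u v^2 = 0, and l has the double factor v. *)
Lemma descent_double :
  x * v = 0 -> y * v * v = 0 -> z * u = 0 -> u * v * v = 0 ->
  v ^+ (d - 1) * z != 0 -> power_descent (v + m) 3.
Proof.
move=> xv yvv zu uvv vz; set l : A := v + m.
have hv : v \in Ac 1 by apply: (gen_comp1 span_e); rewrite !inE eqxx !orbT.
have hl : l \in Ac 1 by rewrite rpredD // (N_comp1 span_e).
have vE := expr_d1 v; have m2 := m_sq0.
have lN n i : n \in N -> l ^+ i * n = v ^+ i * n by move=> hn; exact: (expr_on_N _ _ NN hm hn).
have vx i : v ^+ i.+1 * x = 0 by rewrite exprSr -mulrA [v * x]mulrC xv mulr0.
have vy i : v ^+ i.+2 * y = 0.
  have -> : v ^+ i.+2 * y = v ^+ i * (y * v * v) by rewrite !exprS; ring.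
  by rewrite yvv mulr0.
(* Each term of the expansion contains u v^2 or m^2. This is where the exponent 3 of the double
   factor comes from. *)
have l3u : l ^+ 3 * u = 0.
  have -> : l ^+ 3 * u = (v + 3%:R * m) * (u * v * v) + m * m * ((3%:R * v + m) * u).
    by rewrite /l; ring.
  by rewrite m2 uvv mulr0 mul0r addr0.
have Pu a : exists c, l ^+ 3 * (a * u) = l ^+ 4 * c.
  by exists 0; rewrite mulrCA l3u !mulr0.
have d2 : (d - 2 = (d - 5) + 3)%N by lia.
have d1 : (d - 1 = (d - 3).+2)%N by lia.
apply: descent_of_generators => //.
- apply: (gens_products (P := fun w => exists c, l ^+ 3 * w = l ^+ 4 * c)) => //.
  + by exists 0; rewrite !mulr0.
  + by exists 0; rewrite xv !mulr0.
  + by exists 0; rewrite mulrA lN ?y_in_N // vy mul0r mulr0.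
  + exists z; rewrite mulrA !lN ?z_in_N //; ring.
  + by have [c e] := Pu v; exists c; rewrite [u * v]mulrC.
  + exists (v - m); have -> : l ^+ 3 * (v * v) = l ^+ 4 * (v - m) + l ^+ 3 * (m * m).
      by rewrite /l; ring.
    by rewrite m2 mulr0 addr0.
- exists v, z; split; [exact: hv | exact: (N_comp1 span_e z_in_N) | ].
  rewrite [v * z]mulrC mulrA (lN _ _ z_in_N) mulrAC -vE; exact: vz.
(* Only the coefficients of [v] and [z] have to be shown zero: l^3 kills [u], [x] and [y]. *)
- move=> _ /(comp1_coords span_e)[n [c [c' [hn ->]]]] h.
  have c'0 : c' = 0.
    have := h z; rewrite !inE eqxx !orbT => /(_ isT).
    rewrite (mulrA (l ^+ _) z) (lN _ _ z_in_N) -mulrA !mulrDr (NN z_in_N hn).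
    rewrite -!apolar_scalerAr zu !mulr0 scaler0 !add0r mulrCA [z * _]mulrC -vE => /eqP.
    by rewrite scaler_eq0 (negPf vz) orbF => /eqP.
  have [c1 [c2 [c3 nE]]] := spanN hn.
  rewrite c'0 scale0r addr0 in h *.
  have c30 : c3 = 0.
    have := h v; rewrite !inE eqxx !orbT => /(_ isT).
    rewrite mulrCA mulrDr (lN _ _ hn) mulrDr -!apolar_scalerAr.
    rewrite {2}d2 exprD -mulrA l3u !mulr0 scaler0 addr0 mulrA [v * _]mulrC -vE nE.
    rewrite !mulrDr -!apolar_scalerAr {1 2}d1 vx vy !scaler0 !add0r => /eqP.
    by rewrite scaler_eq0 (negPf vz) orbF => /eqP.
  rewrite mulrDr -apolar_scalerAr l3u scaler0 addr0 (lN _ _ hn) nE c30 scale0r addr0.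
  by rewrite mulrDr -!apolar_scalerAr vx vy !scaler0 addr0.
Qed.

End TwoTerms.
End Generators.
End StringBounds.

(** * The normal forms *)

Section FormDerivatives.
Variable K : fieldType.
Implicit Types (p q F : {mpoly K[5]}).

Lemma mderiv_var (i j : 'I_5) : ('X_i : {mpoly K[5]})^`M(j) = (val i == val j)%:R.
Proof. exact: mderivXU. Qed.

Lemma mderiv_exp n (p : {mpoly K[n]}) k i :
  (p ^+ k)^`M(i) = k%:R * p ^+ k.-1 * p^`M(i).
Proof.
elim: k => [|k IH]; first by rewrite expr0 -mpolyC1 mderivC !mul0r.
rewrite exprS mderivM IH /= -natr1; case: k IH => [|k] _.
  by rewrite expr0; ring.
by rewrite !exprS /=; ring.
Qed.

Lemma mderiv_nat n k i : (k%:R : {mpoly K[n]})^`M(i) = 0.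
Proof. by rewrite -mpolyC_nat mderivC. Qed.

Local Notation i0 := (@Ordinal 5 0 isT).
Local Notation i1 := (@Ordinal 5 1 isT).
Local Notation i2 := (@Ordinal 5 2 isT).
Local Notation i3 := (@Ordinal 5 3 isT).
Local Notation i4 := (@Ordinal 5 4 isT).

Definition mderiv_rules := (mderiv_nat, mderivD, mderivM, mderiv_exp, mderivZ).

Lemma mderiv0_vars : ((pX K)^`M(i0) = 1) * ((pY K)^`M(i0) = 0) *
  ((pZ K)^`M(i0) = 0) * ((pU K)^`M(i0) = 0) * ((pV K)^`M(i0) = 0).
Proof. by rewrite !mderiv_var. Qed.

Lemma mderiv1_vars : ((pX K)^`M(i1) = 0) * ((pY K)^`M(i1) = 1) *
  ((pZ K)^`M(i1) = 0) * ((pU K)^`M(i1) = 0) * ((pV K)^`M(i1) = 0).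
Proof. by rewrite !mderiv_var. Qed.

Lemma mderiv2_vars : ((pX K)^`M(i2) = 0) * ((pY K)^`M(i2) = 0) *
  ((pZ K)^`M(i2) = 1) * ((pU K)^`M(i2) = 0) * ((pV K)^`M(i2) = 0).
Proof. by rewrite !mderiv_var. Qed.

Lemma mderiv3_vars : ((pX K)^`M(i3) = 0) * ((pY K)^`M(i3) = 0) *
  ((pZ K)^`M(i3) = 0) * ((pU K)^`M(i3) = 1) * ((pV K)^`M(i3) = 0).
Proof. by rewrite !mderiv_var. Qed.

Lemma mderiv4_vars : ((pX K)^`M(i4) = 0) * ((pY K)^`M(i4) = 0) *
  ((pZ K)^`M(i4) = 0) * ((pU K)^`M(i4) = 0) * ((pV K)^`M(i4) = 1).
Proof. by rewrite !mderiv_var. Qed.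

Lemma diff_actZr p c F : diff_act p (c *: F) = c *: diff_act p F.
Proof. by have := diff_act_linearr p c F 0; rewrite !addr0 diff_act0r addr0. Qed.

Lemma diff_act_exp i k p (c : K) : p^`M(i) = c%:MP ->
  diff_act ('X_i ^+ k) (p ^+ k) = (c ^+ k * k`!%:R)%:MP.
Proof.
move=> dp; elim: k => [|k IH]; first by rewrite !expr0 diff_act1 mulr1 mpolyC1.
rewrite exprSr diff_actM diff_actXU mderiv_exp dp /=.
have -> : k.+1%:R * p ^+ k * c%:MP = (k.+1%:R * c) *: p ^+ k.
  by rewrite -mul_mpolyC mpolyCM rmorph_nat; ring.
rewrite diff_actZr IH -mul_mpolyC -mpolyCM; congr (_%:MP).
by rewrite factS natrM exprS; ring.
Qed.

Lemma incUV_mderiv (p : {mpoly K[2]}) (i : 'I_5) : (i < 3)%N -> (incUV p)^`M(i) = 0.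
Proof.
move=> lti; rewrite /incUV mderiv_comp !big_ord_recl big_ord0.
have i3 : (3 == i :> nat)%N = false by rewrite gtn_eqF.
have i4 : (4 == i :> nat)%N = false by rewrite gtn_eqF // ltnW.
rewrite !(tnth_nth 0) /= !mderiv_var /= i3 i4.
by rewrite !mulr0 !addr0.
Qed.

Lemma var_homog i : ('X_i : {mpoly K[5]}) \is 1.-homog.
Proof. by rewrite dhomogX /= mdeg1. Qed.

Lemma incUV_homog e (p : {mpoly K[2]}) : p \is e.-homog -> incUV p \is e.-homog.
Proof.
apply: comp_mpoly_homog => i; rewrite (tnth_nth 0).
by case: i => [[|[]]] //= _; apply: var_homog.
Qed.

(** Degree at most one in X, Y, Z jointly, phrased by derivatives so that it translates directly
    into N^2 = 0 in A_F. *)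
Definition XYZ_linear F :=
  forall i j : 'I_5, (i < 3)%N -> (j < 3)%N -> F^`M(i)^`M(j) = 0.

Lemma incUV_XYZ_linear (p0 p1 p2 G : {mpoly K[2]}) :
  XYZ_linear (pX K * incUV p0 + pY K * incUV p1 + pZ K * incUV p2 + incUV G).
Proof.
move=> i j lti ltj.
rewrite !mderivD !mderivM !(incUV_mderiv _ lti) !mderiv_var !mulr0 !addr0.
by do !rewrite mderivM (incUV_mderiv _ ltj) mulr0 addr0; rewrite -!mpolyC_nat
  !mderivC !mul0r !addr0.
Qed.

Lemma perazzo_homog d F : (0 < d)%N -> perazzo_form d F -> F \is d.-homog.
Proof.
move=> d_gt0 [p0 [p1 [p2 [G [_ ->]]]]].
have hp (p : dhomog 2 K d.-1) i : 'X_i * incUV p \is d.-homog.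
  have := dhomogM (var_homog i) (incUV_homog (dhomog_is_dhomog p)).
  by rewrite add1n prednK.
by rewrite !rpredD ?hp // incUV_homog // dhomog_is_dhomog.
Qed.

Lemma incUV0 : incUV (0 : {mpoly K[2]}) = 0.
Proof. exact: comp_mpoly0. Qed.

Lemma incUVD (p q : {mpoly K[2]}) : incUV (p + q) = incUV p + incUV q.
Proof. exact: comp_mpolyD. Qed.

Lemma incUVZ c (p : {mpoly K[2]}) : incUV (c *: p) = c *: incUV p.
Proof. exact: comp_mpolyZ. Qed.

Lemma incUVM (p q : {mpoly K[2]}) : incUV (p * q) = incUV p * incUV q.
Proof. exact: rmorphM. Qed.

Lemma incUVX (p : {mpoly K[2]}) k : incUV (p ^+ k) = incUV p ^+ k.
Proof. exact: rmorphXn. Qed.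

Lemma form_i_XYZ_linear d : XYZ_linear (form_i K d).
Proof.
pose U : {mpoly K[2]} := 'X_ord0; pose V : {mpoly K[2]} := 'X_(lift ord0 ord0).
have hU : incUV U = pU K by rewrite /incUV comp_mpolyXU.
have hV : incUV V = pV K by rewrite /incUV comp_mpolyXU.
have := @incUV_XYZ_linear (U ^+ (d - 1)) (U ^+ (d - 2) * V) (U ^+ (d - 3) * V ^+ 2) 0.
rewrite incUV0 addr0 !incUVM !incUVX hU hV !mulrA => h; rewrite /form_i expr2 !mulrA; exact: h.
Qed.

Lemma form_ii_XYZ_linear d : XYZ_linear (form_ii K d).
Proof.
pose U : {mpoly K[2]} := 'X_ord0; pose V : {mpoly K[2]} := 'X_(lift ord0 ord0).
have hU : incUV U = pU K by rewrite /incUV comp_mpolyXU.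
have hV : incUV V = pV K by rewrite /incUV comp_mpolyXU.
have := @incUV_XYZ_linear (U ^+ (d - 1)) (U ^+ (d - 2) * V) (V ^+ (d - 1)) 0.
rewrite incUV0 addr0 !incUVM !incUVX hU hV !mulrA; exact.
Qed.

Lemma form_iii_XYZ_linear d (lam : K) : XYZ_linear (form_iii d lam).
Proof.
pose U : {mpoly K[2]} := 'X_ord0; pose V : {mpoly K[2]} := 'X_(lift ord0 ord0).
have hU : incUV U = pU K by rewrite /incUV comp_mpolyXU.
have hV : incUV V = pV K by rewrite /incUV comp_mpolyXU.
have := @incUV_XYZ_linear (U ^+ (d - 1)) ((U + lam *: V) ^+ (d - 1)) (V ^+ (d - 1)) 0.
rewrite incUV0 addr0 !incUVX incUVD incUVZ hU hV; exact.
Qed.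

Lemma diff_actMX i p F : diff_act (p * 'X_i) F = diff_act p F^`M(i).
Proof. by rewrite diff_actM diff_actXU. Qed.

Section Degree.
Variables (d : nat) (lam : K).
Hypotheses (d_ge5 : (5 <= d)%N) (charK : [pchar K] =i pred0).
Local Notation X := (pX K). Local Notation Y := (pY K). Local Notation Z := (pZ K).
Local Notation U := (pU K). Local Notation V := (pV K).
Local Notation L := (U + lam *: V).

Lemma form_i_VVV : diff_act (V * V * V) (form_i K d) = 0.
Proof.
rewrite !diff_actMX diff_actXU.
have -> : (form_i K d)^`M(i4) = Y * U ^+ (d - 2) + Z * U ^+ (d - 3) * (2%:R * V).
  by rewrite /form_i !mderiv_rules !mderiv4_vars /=; ring.
have -> : (Y * U ^+ (d - 2) + Z * U ^+ (d - 3) * (2%:R * V))^`M(i4) =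
    Z * U ^+ (d - 3) * 2%:R.
  by rewrite !mderiv_rules !mderiv4_vars; ring.
by rewrite !mderiv_rules !mderiv4_vars; ring.
Qed.

Lemma form_ii_X : (form_ii K d)^`M(i0) = U ^+ (d - 1).
Proof. by rewrite /form_ii !mderiv_rules !mderiv0_vars; ring. Qed.

Lemma form_ii_Y : (form_ii K d)^`M(i1) = U ^+ (d - 2) * V.
Proof. by rewrite /form_ii !mderiv_rules !mderiv1_vars; ring. Qed.

Lemma form_ii_Z : (form_ii K d)^`M(i2) = V ^+ (d - 1).
Proof. by rewrite /form_ii !mderiv_rules !mderiv2_vars; ring. Qed.

(** The factor (d - 1)^-1 compares the V-derivative of U^(d-2) V with the U-derivative of U^(d-1).
    The cubic relation is u v^2. *)
Lemma form_ii_relations :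
  [/\ diff_act (V * X) (form_ii K d) = 0, diff_act (V * V * Y) (form_ii K d) = 0,
      diff_act (U * Z) (form_ii K d) = 0, diff_act (U * V * V) (form_ii K d) = 0 &
      diff_act (V * Y - (d - 1)%:R^-1 *: (U * X)) (form_ii K d) = 0].
Proof.
have d1 : ((d - 1)%:R : K) != 0 by rewrite ((pcharf0P K).1 charK); lia.
have UV k : (U ^+ k * V)^`M(i4) = U ^+ k.
  by rewrite !mderiv_rules !mderiv4_vars; ring.
have U4 k : (U ^+ k)^`M(i4) = 0 by rewrite mderiv_exp mderiv4_vars mulr0.
split.
- by rewrite diff_actMX form_ii_X diff_actXU U4.
- by rewrite !diff_actMX form_ii_Y diff_actXU UV U4.
- by rewrite diff_actMX form_ii_Z diff_actXU mderiv_exp mderiv3_vars mulr0.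
- rewrite !diff_actMX diff_actXU.
  have -> : (form_ii K d)^`M(i4) = Y * U ^+ (d - 2) + (d - 1)%:R * Z * V ^+ (d - 1).-1.
    by rewrite /form_ii !mderiv_rules !mderiv4_vars /=; ring.
  have -> : (Y * U ^+ (d - 2) + (d - 1)%:R * Z * V ^+ (d - 1).-1)^`M(i4) =
      (d - 1)%:R * (d - 1).-1%:R * Z * V ^+ (d - 1).-2.
    by rewrite !mderiv_rules !mderiv4_vars /=; ring.
  by rewrite !mderiv_rules !mderiv3_vars /=; ring.
- rewrite diff_actB diff_actZ !diff_actMX form_ii_X form_ii_Y !diff_actXU UV.
  rewrite mderiv_exp mderiv3_vars mulr1 -mpolyC_nat mul_mpolyC scalerA mulVf //.
  by rewrite scale1r -subn1 -subnDA subrr.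
Qed.

Lemma factorial_neq0 k : (k`!%:R : K) != 0.
Proof. by rewrite ((pcharf0P K).1 charK) -lt0n fact_gt0. Qed.

Lemma diff_act_exp_neq0 i k p : p^`M(i) = 1 -> diff_act ('X_i ^+ k) (p ^+ k) != 0.
Proof.
rewrite -mpolyC1 => dp; rewrite (diff_act_exp _ dp) expr1n mul1r mpolyC_eq0.
exact: factorial_neq0.
Qed.

Lemma form_ii_nonzero :
  diff_act (U ^+ (d - 1) * X) (form_ii K d) != 0 /\
  diff_act (V ^+ (d - 1) * Z) (form_ii K d) != 0.
Proof.
rewrite !diff_actMX form_ii_X form_ii_Z.
by split; apply: diff_act_exp_neq0; rewrite ?mderiv3_vars ?mderiv4_vars.
Qed.

Lemma form_iii_X : (form_iii d lam)^`M(i0) = U ^+ (d - 1).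
Proof.
by rewrite /form_iii !mderiv_rules !mderiv0_vars scaler0; ring.
Qed.

Lemma form_iii_Y : (form_iii d lam)^`M(i1) = L ^+ (d - 1).
Proof.
by rewrite /form_iii !mderiv_rules !mderiv1_vars scaler0; ring.
Qed.

Lemma form_iii_Z : (form_iii d lam)^`M(i2) = V ^+ (d - 1).
Proof.
by rewrite /form_iii !mderiv_rules !mderiv2_vars scaler0; ring.
Qed.

(** The V-derivative of a power of U + lam V is [lam] times its U-derivative. The cubic relation is
    u v (v - lam u). *)
Lemma form_iii_relations :
  [/\ diff_act (V * X) (form_iii d lam) = 0, diff_act (U * Z) (form_iii d lam) = 0,
      diff_act (V * Y - lam *: (U * Y)) (form_iii d lam) = 0 &
      diff_act (V * U * V - lam *: (U * U * V)) (form_iii d lam) = 0].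
Proof.
have L3 : L^`M(i3) = 1 by rewrite !mderiv_rules !mderiv3_vars scaler0 addr0.
have L4 : L^`M(i4) = lam%:MP.
  by rewrite !mderiv_rules !mderiv4_vars add0r -mul_mpolyC mulr1.
split.
- by rewrite diff_actMX form_iii_X diff_actXU mderiv_exp mderiv4_vars mulr0.
- by rewrite diff_actMX form_iii_Z diff_actXU mderiv_exp mderiv3_vars mulr0.
- rewrite diff_actB diff_actZ !diff_actMX form_iii_Y !diff_actXU !mderiv_exp L3 L4.
  by rewrite mulr1 mulrC mul_mpolyC subrr.
- rewrite diff_actB diff_actZ !diff_actMX !diff_actXU.
  have -> : (form_iii d lam)^`M(i4) =
      lam%:MP * (d - 1)%:R * Y * L ^+ (d - 1).-1 + (d - 1)%:R * Z * V ^+ (d - 1).-1.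
    rewrite /form_iii !mderivD !mderivM !mderiv_exp L4 !mderiv4_vars; ring.
  have -> : (lam%:MP * (d - 1)%:R * Y * L ^+ (d - 1).-1 +
      (d - 1)%:R * Z * V ^+ (d - 1).-1)^`M(i3) =
      lam%:MP * (d - 1)%:R * (d - 1).-1%:R * Y * L ^+ (d - 1).-2.
    rewrite !mderivD !mderivM !mderiv_exp mderivC mderiv_nat L3 !mderiv3_vars /=; ring.
  rewrite !mderivM !mderiv_exp !mderivC !mderiv_nat L3 L4 !mderiv3_vars !mderiv4_vars.
  by rewrite -!mul_mpolyC; ring.
Qed.

Lemma form_iii_nonzero :
  [/\ diff_act (U ^+ (d - 1) * X) (form_iii d lam) != 0,
      diff_act (U ^+ (d - 1) * Y) (form_iii d lam) != 0 &
      diff_act (V ^+ (d - 1) * Z) (form_iii d lam) != 0].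
Proof.
rewrite !diff_actMX form_iii_X form_iii_Y form_iii_Z.
split; apply: diff_act_exp_neq0; rewrite ?mderiv3_vars ?mderiv4_vars //.
by rewrite mderivD mderivZ !mderiv3_vars scaler0 addr0.
Qed.

End Degree.
End FormDerivatives.

(** * Non-Lefschetz linear forms, by the factorization of the cubic relation *)

Section NonLefschetz.
Variables (K : closedFieldType) (d : nat) (F : {mpoly K[5]}).
Hypotheses (charK : [pchar K] =i pred0) (homF : F \is d.-homog).
Hypothesis (d_ge5 : (5 <= d)%N).
Hypothesis (hilbF : forall i : nat, hilbert F i = nth 0%N (min_hilbert_seq d) i).
Local Notation A := (apolar_alg F).
Local Notation Ac := (apolar_comp F).

Lemma expr_eigen (a b n : A) (e : K) i : a * n = e *: (b * n) ->
  a ^+ i * n = e ^+ i *: (b ^+ i * n).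
Proof.
move=> h; elim: i => [|i IH]; first by rewrite !expr0 scale1r.
rewrite exprSr -mulrA h -apolar_scalerAr mulrCA IH -apolar_scalerAr scalerA -exprS.
by rewrite mulrA -exprS.
Qed.

Lemma scale_neq0 (c : K) (a : A) : c != 0 -> a != 0 -> c *: a != 0.
Proof. by move=> c0 a0; rewrite scaler_eq0 negb_or c0. Qed.

Lemma span_eq (s t : seq A) :
  {subset s <= <<t>>%VS} -> {subset t <= <<s>>%VS} -> <<s>>%VS = <<t>>%VS.
Proof. by move=> st ts; apply: subv_anti; rewrite !(introT span_subvP). Qed.

Lemma memv_span_scale (s : seq A) (c : K) (a : A) : c != 0 -> c *: a \in s ->
  a \in <<s>>%VS.
Proof.
by move=> c0 cs; rewrite -[a]scale1r -(mulVf c0) -scalerA rpredZ // memv_span.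
Qed.

Variables (x y z u v : A).
Local Notation N := <<[:: x; y; z]>>%VS.
Hypothesis (span_e : Ac 1 = <<[:: x; y; z; u; v]>>%VS).
Hypothesis (NN : forall a b : A, a \in N -> b \in N -> a * b = 0).

Lemma binform_Xn i k : (k <= i)%N -> binform u v i 'X^k = u ^+ k * v ^+ (i - k).
Proof.
move=> lek; rewrite /binform (bigD1 (Ordinal (lek : (k < i.+1)%N))) //=.
rewrite coefXn eqxx scale1r big1 ?addr0 // => j ne.
by rewrite coefXn (_ : (j == k :> nat) = false) ?scale0r //; apply: negbTE.
Qed.

Variable l : A.
Hypotheses (l1 : l \in Ac 1) (nwl : ~ weak_lefschetz l).

Lemma factor_of_cubic (q : {poly K}) : (size q <= 4)%N -> binform u v 3 q = 0 ->
  exists m c c', [/\ m \in N, l = c *: u + c' *: v + m &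
    c = 0 \/ c != 0 /\ q.[- (c' / c)] = 0].
Proof.
move=> sq hq; have [m [c [c' [hm lE]]]] := comp1_coords span_e l1.
have lE' : l = c *: u + c' *: v + m by rewrite lE -addrA addrC.
exists m, c, c'; split=> //; have [|c0] := eqVneq c 0; [by left | right].
split=> //; apply: (weak_lefschetz_root charK homF d_ge5 hilbF span_e NN sq _ hm c0).
  by rewrite hq linear0.
by rewrite -lE'.
Qed.

Variable zs : seq (A * nat).
Hypothesis (jzs : jordan_basis ( *%R l) zs).

Lemma strings_triple : v * v * v = 0 ->
  {in string_lengths zs, forall p, p <= 4}%N.
Proof.
move=> vvv; apply: (string_length_nilp homF d_ge5 jzs).
(* The constant polynomial 1 dehomogenizes v^3. It has no root, so only multiples of [v] remain. *)
have [||m [c [c' [hm lE c0]]]] := @factor_of_cubic 'X^0; first by rewrite size_polyXn.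
  by rewrite binform_Xn // expr0 mul1r !exprS expr0 mulr1 mulrA.
have {}c0 : c = 0.
  by case: c0 => // -[_]; rewrite hornerXn expr0 => /eqP; rewrite oner_eq0.
rewrite lE c0 scale0r add0r; pose C := c' *: (1 : A).
have -> : c' *: v = C * v by rewrite -apolar_scalerAl mul1r.
have -> : (C * v + m) ^+ 4 = v * v * v * (C ^+ 4 * v + 4%:R * C ^+ 3 * m) +
    m * m * (6%:R * C ^+ 2 * v ^+ 2 + 4%:R * C * v * m + m * m) by ring.
by rewrite vvv (NN hm hm) !mul0r addr0.
Qed.

Lemma span_perm3 (s : seq A) : s =i [:: x; y; z] -> <<s>>%VS = N.
Proof. exact: eq_span. Qed.

Lemma strings_double (g : K) : g != 0 ->
  x * v = 0 -> y * v * v = 0 -> z * u = 0 -> u * v * v = 0 ->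
  y * v = g *: (x * u) -> u ^+ (d - 1) * x != 0 -> v ^+ (d - 1) * z != 0 ->
  {in string_lengths zs, forall p, d - 1 <= p \/ p <= 3}%N.
Proof.
move=> g0 xv yvv zu uvv yv ux vz.
have weaken : {in string_lengths zs, forall p, d - 1 <= p \/ p <= 2}%N ->
    {in string_lengths zs, forall p, d - 1 <= p \/ p <= 3}%N.
  by move=> h p /h[|/leqW]; [left | right].
(* ['X^1] dehomogenizes u v^2: the root 0 is the simple factor [u], and the double factor [v] is the
   case [c] = 0. *)
have [||m [c [c' [hm lE c0]]]] := @factor_of_cubic 'X^1; first by rewrite size_polyXn.
  by rewrite binform_Xn // expr1 expr2 mulrA.
case: c0 => [c0|[c0]].
  rewrite c0 scale0r add0r in lE; have [c'0|c'0] := eqVneq c' 0.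
    apply: weaken; apply: (string_length_descent homF d_ge5 jzs).
    by rewrite lE c'0 scale0r add0r; apply: (descent_zero NN).
  apply: (string_length_descent homF d_ge5 jzs); rewrite lE.
  apply: (descent_double (x := x) (y := y) (z := z) (u := u) homF d_ge5 _ NN hm).
  - rewrite span_e; apply: span_eq => a; rewrite !inE.
      case/or4P=> [/eqP->|/eqP->|/eqP->|/orP[]/eqP->];
        try by rewrite memv_span // !inE eqxx ?orbT.
      by apply: (memv_span_scale c'0); rewrite !inE eqxx !orbT.
    case/or4P=> [/eqP->|/eqP->|/eqP->|/orP[]/eqP->]; rewrite ?rpredZ //;
      by rewrite memv_span // !inE eqxx ?orbT.
  - by rewrite -apolar_scalerAr xv scaler0.
  - by rewrite -!apolar_scalerAr -apolar_scalerAl yvv !scaler0.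
  - exact: zu.
  - by rewrite -!apolar_scalerAr -apolar_scalerAl uvv !scaler0.
  - rewrite (@expr_eigen _ v z c'); last by rewrite -apolar_scalerAl.
    by apply: scale_neq0; [apply: expf_neq0 | apply: vz].
rewrite hornerXn expr1 => /eqP; rewrite oppr_eq0 mulf_eq0 invr_eq0 (negPf c0) orbF.
move=> /eqP c'0; apply: weaken; apply: (string_length_descent homF d_ge5 jzs).
rewrite lE c'0 scale0r addr0.
apply: (descent_simple (x := x) (y := y) (z := z) (v := v) (g := g / c) homF d_ge5 _ NN hm).
- rewrite span_e; apply: span_eq => a; rewrite !inE.
    case/or4P=> [/eqP->|/eqP->|/eqP->|/orP[]/eqP->];
      try by rewrite memv_span // !inE eqxx ?orbT.
    by apply: (memv_span_scale c0); rewrite !inE eqxx !orbT.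
  case/or4P=> [/eqP->|/eqP->|/eqP->|/orP[]/eqP->]; rewrite ?rpredZ //;
    by rewrite memv_span // !inE eqxx ?orbT.
- by rewrite mulf_neq0 ?invr_eq0.
- exact: xv.
- by rewrite -apolar_scalerAr zu scaler0.
- by rewrite -apolar_scalerAr scalerA divfK.
- by rewrite -!apolar_scalerAl uvv scaler0.
- rewrite (@expr_eigen _ u x c); last by rewrite -apolar_scalerAl.
  by apply: scale_neq0; [apply: expf_neq0 | apply: ux].
Qed.

(** Each of the three distinct factors kills one of [x], [y], [z]. The same descent lemma serves for
    all three, with that generator in the role of its [x] and the others permuted accordingly. *)
Lemma strings_distinct (lam : K) : lam != 0 ->
  x * v = 0 -> z * u = 0 -> y * v = lam *: (y * u) ->
  u * v * v = lam *: (u * u * v) ->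
  u ^+ (d - 1) * x != 0 -> u ^+ (d - 1) * y != 0 -> v ^+ (d - 1) * z != 0 ->
  {in string_lengths zs, forall p, d - 1 <= p \/ p <= 2}%N.
Proof.
move=> lam0 xv zu yv uvv ux uy vz; apply: (string_length_descent homF d_ge5 jzs).
have [||m [c [c' [hm lE c0]]]] := @factor_of_cubic (lam *: 'X^2 - 'X^1).
- rewrite (leq_trans (size_polyD _ _)) // geq_max size_polyN size_polyXn andbT.
  by rewrite (leq_trans (size_scale_leq _ _)) // size_polyXn.
- by rewrite linearB linearZ /= !binform_Xn // !expr1 !expr2 -uvv mulrA subrr.
have vy : v ^+ (d - 1) * y != 0.
  rewrite (@expr_eigen _ u y lam); last by rewrite mulrC yv mulrC.
  by apply: scale_neq0; [apply: expf_neq0 | apply: uy].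
case: c0 => [c0|[c0]].
  rewrite c0 scale0r add0r in lE; have [c'0|c'0] := eqVneq c' 0.
    by rewrite lE c'0 scale0r add0r; apply: (descent_zero NN).
  have eN : <<[:: x; z; y]>>%VS = N.
    by apply: span_perm3 => a; rewrite !inE; case: (a == x); case: (a == y); case: (a == z).
  rewrite lE; apply: (descent_distinct (x := x) (y := z) (z := y) (v := u)
    (g := (lam * c')^-1) homF d_ge5 _ _ _).
  - rewrite span_e; apply: span_eq => a; rewrite !inE.
      case/or4P=> [/eqP->|/eqP->|/eqP->|/orP[]/eqP->];
        try by rewrite memv_span // !inE eqxx ?orbT.
      by apply: (memv_span_scale c'0); rewrite !inE eqxx !orbT.
    case/or4P=> [/eqP->|/eqP->|/eqP->|/orP[]/eqP->]; rewrite ?rpredZ //;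
      by rewrite memv_span // !inE eqxx ?orbT.
  - by rewrite eN.
  - by rewrite eN.
  - by rewrite invr_eq0 mulf_neq0.
  - by rewrite -apolar_scalerAr xv scaler0.
  - exact: zu.
  - rewrite -apolar_scalerAr yv !scalerA -mulrA [c' * lam]mulrC mulVf ?scale1r //.
    by rewrite mulf_neq0.
  - rewrite -!apolar_scalerAl -!apolar_scalerAr -!apolar_scalerAl !scalerA.
    have -> : v * u * u = u * u * v by ring.
    have -> : v * v * u = lam *: (u * u * v) by rewrite -uvv; ring.
    by rewrite scalerA; congr (_ *: _); field; rewrite lam0 c'0.
  - rewrite (@expr_eigen _ v z c'); last by rewrite -apolar_scalerAl.
    by apply: scale_neq0; [apply: expf_neq0 | apply: vz].
  - rewrite (@expr_eigen _ v y c'); last by rewrite -apolar_scalerAl.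
    by apply: scale_neq0; [apply: expf_neq0 | apply: vy].
have -> : (lam *: 'X^2 - 'X^1).[- (c' / c)] = - (c' / c) * (lam * (- (c' / c)) - 1).
  by rewrite hornerD hornerN hornerZ !hornerXn; ring.
move=> /eqP; rewrite mulf_eq0 oppr_eq0 mulf_eq0 invr_eq0 (negPf c0) orbF.
case/orP => [/eqP c'0|]; last first.
  (* In this case c = - lam c', so the part of [l] in u, v is a multiple of v - lam u, the factor
     that kills [y]. *)
  rewrite subr_eq0 mulrN mulrA -mulNr => /eqP/(congr1 (fun t => t * c)).
  rewrite divfK // mul1r => cE.
  have c'0 : c' != 0 by apply: contraNneq c0 => h; rewrite -cE h mulr0 oppr0.
  have eN : <<[:: y; z; x]>>%VS = N.
    by apply: span_perm3 => a; rewrite !inE; case: (a == x); case: (a == y); case: (a == z).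
  have yu' : y * (c *: u + c' *: v) = 0.
    rewrite mulrDr -!apolar_scalerAr yv scalerA -scalerDl -cE [c' * lam]mulrC.
    by rewrite addNr scale0r.
  have u'x : (c *: u + c' *: v) * x = c *: (u * x).
    by rewrite mulrDl -!apolar_scalerAl [v * x]mulrC xv scaler0 addr0.
  have u'z : (c *: u + c' *: v) * z = c' *: (v * z).
    by rewrite mulrDl -!apolar_scalerAl [u * z]mulrC zu scaler0 add0r.
  have u'uv : (c *: u + c' *: v) * (u * v) = 0.
    rewrite mulrDl -!apolar_scalerAl.
    have -> : v * (u * v) = lam *: (u * (u * v)) by rewrite mulrCA mulrA uvv mulrA.
    by rewrite scalerA -scalerDl -cE [c' * lam]mulrC addNr scale0r.
  rewrite lE; apply: (descent_distinct (x := y) (y := z) (z := x) (v := u)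
    (g := c^-1) homF d_ge5 _ _ _).
  - rewrite span_e; apply: span_eq => a; rewrite !inE.
      case/or4P=> [/eqP->|/eqP->|/eqP->|/orP[]/eqP->];
        try by rewrite memv_span // !inE eqxx ?orbT.
      have vE : c'^-1 *: ((c *: u + c' *: v) - c *: u) = v.
        by rewrite addrC addKr scalerA mulVf // scale1r.
      by rewrite -[X in X \in _]vE rpredZ // rpredB ?rpredZ // memv_span // !inE eqxx !orbT.
    case/or4P=> [/eqP->|/eqP->|/eqP->|/orP[]/eqP->]; rewrite ?rpredD ?rpredZ //;
      by rewrite memv_span // !inE eqxx ?orbT.
  - by rewrite eN.
  - by rewrite eN.
  - by rewrite invr_eq0.
  - exact: yu'.
  - exact: zu.
  - by rewrite [x * (_ + _)]mulrC u'x scalerA mulVf // scale1r mulrC.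
  - set u' := c *: u + c' *: v in u'uv *.
    have u'u : u' * u = c *: (u * u) + c' *: (u * v).
      by rewrite mulrDl -!apolar_scalerAl [v * u]mulrC.
    have -> : u' * u' * u = c *: (u' * u * u).
      by rewrite -mulrA {1}u'u mulrDr -!apolar_scalerAr u'uv scaler0 addr0 mulrA.
    by rewrite scalerA mulVf // scale1r.
  - rewrite (expr_eigen _ u'z).
    by apply: scale_neq0; [apply: expf_neq0 | apply: vz].
  - rewrite (expr_eigen _ u'x).
    by apply: scale_neq0; [apply: expf_neq0 | apply: ux].
have eN : <<[:: z; x; y]>>%VS = N.
  by apply: span_perm3 => a; rewrite !inE; case: (a == x); case: (a == y); case: (a == z).
rewrite lE c'0 scale0r addr0; apply: (descent_distinct (x := z) (y := x) (z := y)
  (v := v) (g := lam / c) homF d_ge5 _ _ _).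
- rewrite span_e; apply: span_eq => a; rewrite !inE.
    case/or4P=> [/eqP->|/eqP->|/eqP->|/orP[]/eqP->];
      try by rewrite memv_span // !inE eqxx ?orbT.
    by apply: (memv_span_scale c0); rewrite !inE eqxx !orbT.
  case/or4P=> [/eqP->|/eqP->|/eqP->|/orP[]/eqP->]; rewrite ?rpredZ //;
    by rewrite memv_span // !inE eqxx ?orbT.
- by rewrite eN.
- by rewrite eN.
- by rewrite mulf_neq0 ?invr_eq0.
- by rewrite -apolar_scalerAr zu scaler0.
- exact: xv.
- by rewrite -apolar_scalerAr scalerA divfK.
- rewrite -!apolar_scalerAl -!apolar_scalerAr -!apolar_scalerAl !scalerA uvv scalerA.
  by congr (_ *: _); field.
- rewrite (@expr_eigen _ u x c); last by rewrite -apolar_scalerAl.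
  by apply: scale_neq0; [apply: expf_neq0 | apply: ux].
- rewrite (@expr_eigen _ u y c); last by rewrite -apolar_scalerAl.
  by apply: scale_neq0; [apply: expf_neq0 | apply: uy].
Qed.

End NonLefschetz.

(** * Generators of A_F adapted to a linear change of variables *)

Lemma mem_ord5 (T : eqType) (f : 'I_5 -> T) (i : 'I_5) :
  f i \in [:: f (@Ordinal 5 0 isT); f (@Ordinal 5 1 isT); f (@Ordinal 5 2 isT);
            f (@Ordinal 5 3 isT); f (@Ordinal 5 4 isT)].
Proof.
by case: i => [[|[|[|[|[|//]]]]] lti]; rewrite !inE (bool_irrelevance lti isT)
  eqxx ?orbT.
Qed.

Section Presentation.
Variables (K : fieldType) (d : nat) (F F0 : {mpoly K[5]}) (M : 'M[K]_5).
Hypotheses (uM : M \in unitmx) (FE : lin_subst M F = F0).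
Local Notation A := (apolar_alg F).
Implicit Types (p q : {mpoly K[5]}).

(* The surjection of K[x,y,z,u,v] onto A_F with kernel Ann F0. *)
Definition apolar_coord_map p : A := apolar_pi F (lin_subst M^T p).
Local Notation phi := apolar_coord_map.

(** Substitution by an invertible matrix is injective, so the transformation rule
    [diff_act_lin_subst] identifies the two annihilators. *)
Lemma phi_eq0 p : phi p = 0 <-> diff_act p F0 = 0.
Proof.
rewrite /phi apolar_pi_eq0 -FE diff_act_lin_subst; split=> [->|h].
  exact: comp_mpoly0.
by rewrite -(lin_substK (diff_act _ F) uM) h; apply: comp_mpoly0.
Qed.

Lemma phi_eq p q : diff_act (p - q) F0 = 0 -> phi p = phi q.
Proof.
move/phi_eq0; rewrite /phi /lin_subst comp_mpolyB linearB => /eqP.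
by rewrite subr_eq0 => /eqP.
Qed.

Lemma phi_neq0 p : diff_act p F0 != 0 -> phi p != 0.
Proof. by apply: contra_neq => /phi_eq0. Qed.

Lemma phiM p q : phi (p * q) = phi p * phi q.
Proof. by rewrite /phi /lin_subst rmorphM /= apolar_piM. Qed.

Lemma phiZ c p : phi (c *: p) = c *: phi p.
Proof. by rewrite /phi /lin_subst comp_mpolyZ linearZ. Qed.

Lemma phi_sum (I : Type) (r : seq I) (f : I -> {mpoly K[5]}) :
  phi (\sum_(i <- r) f i) = \sum_(i <- r) phi (f i).
Proof.
elim: r => [|i r IH]; last first.
  by rewrite !big_cons -IH /phi /lin_subst comp_mpolyD linearD.
by rewrite !big_nil /phi /lin_subst comp_mpoly0 linear0.
Qed.

Lemma phiX p k : phi (p ^+ k) = phi p ^+ k.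
Proof.
elim: k => [|k IH]; last by rewrite !exprS phiM IH.
by rewrite !expr0 /phi /lin_subst comp_mpoly1.
Qed.

Local Notation vars := [:: phi (pX K); phi (pY K); phi (pZ K); phi (pU K); phi (pV K)].

Lemma phi_var_mem i : phi 'X_i \in vars.
Proof. exact: (mem_ord5 (fun j => phi 'X_j)). Qed.

Lemma comp1_phi : apolar_comp F 1 = <<vars>>%VS.
Proof.
have hM := unitmx_tr M; rewrite uM in hM.
apply: subv_anti; apply/andP; split; last first.
  apply/span_subvP => a; rewrite !inE => ha.
  have mem i : phi 'X_i \in apolar_comp F 1.
    exact: comp_pi (lin_subst_homog _ (var_homog _ i)).
  by case/or4P: ha => [/eqP->|/eqP->|/eqP->|/orP[]/eqP->]; apply: mem.
apply/subvP => _ /apolar_compP[r hr ->].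
rewrite -(lin_substKV r hM) -/(phi _).
have /dhomogP := lin_subst_homog (invmx M^T) hr.
move: (lin_subst _ r) => q hq.
have -> : phi q = \sum_(m <- msupp q) q@_m *: phi 'X_[m].
  by rewrite {1}[q]mpolyE phi_sum; apply: eq_bigr => m _; rewrite phiZ.
rewrite big_seq; apply: rpred_sum => m hm.
have /eqP/mdeg1P[i /eqP ->] := hq m hm.
by rewrite rpredZ //; apply/memv_span/phi_var_mem.
Qed.

Lemma phi_XYZ_mul : XYZ_linear F0 ->
  forall a b : A, a \in <<[:: phi (pX K); phi (pY K); phi (pZ K)]>>%VS ->
  b \in <<[:: phi (pX K); phi (pY K); phi (pZ K)]>>%VS -> a * b = 0.
Proof.
move=> lin a b ha hb.
have z (i j : 'I_5) : (i < 3)%N -> (j < 3)%N -> phi 'X_i * phi 'X_j = 0.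
  by move=> lti ltj; rewrite -phiM; apply/phi_eq0; rewrite diff_actMX diff_actXU lin.
have gen a' : a' \in [:: phi (pX K); phi (pY K); phi (pZ K)] ->
    exists2 i : 'I_5, (i < 3)%N & a' = phi 'X_i.
  rewrite !inE => /or3P[]/eqP->; first by exists (@Ordinal 5 0 isT).
    by exists (@Ordinal 5 1 isT).
  by exists (@Ordinal 5 2 isT).
have kerb : (<<[:: phi (pX K); phi (pY K); phi (pZ K)]>> <= lker (amul b))%VS.
  apply/span_subvP => _ /gen[i lti ->]; rewrite memv_ker amulE mulrC.
  have : (<<[:: phi (pX K); phi (pY K); phi (pZ K)]>> <= lker (amul (phi 'X_i)))%VS.
    apply/span_subvP => _ /gen[j ltj ->]; rewrite memv_ker amulE.
    by apply/eqP; apply: z.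
  by move=> /subvP/(_ b hb); rewrite memv_ker amulE.
by have := subvP kerb a ha; rewrite memv_ker amulE mulrC => /eqP.
Qed.

End Presentation.

Theorem theorem4p4 (K : closedFieldType) (charK : [pchar K] =i pred0)
    (d : nat) (d_ge5 : (5 <= d)%N) (F : {mpoly K[5]})
    (perF : perazzo_form d F)
    (hilbF : forall i : nat, hilbert F i = nth 0%N (min_hilbert_seq d) i) :
  [/\ exists2 l : apolar_alg F, weak_lefschetz l &
        jordan_type ( *%R l) ([:: d.+1] ++ nseq 3 (d - 1)%N ++ nseq 2 (d - 2)%N),
      exists2 l : apolar_alg F, weak_lefschetz l &
        jordan_type ( *%R l) (nseq 2 d ++ nseq 2 (d - 1)%N ++ nseq 2 (d - 2)%N) &
      forall l : apolar_alg F, l \in apolar_comp F 1 -> ~ weak_lefschetz l ->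
      forall zs : seq (apolar_alg F * nat), jordan_basis ( *%R l) zs ->
      [/\ lin_equiv F (form_i K d) ->
            {in string_lengths zs, forall p, p <= 4}%N,
          lin_equiv F (form_ii K d) ->
            {in string_lengths zs, forall p, d - 1 <= p \/ p <= 3}%N &
          forall lam : K, lam != 0 -> lin_equiv F (form_iii d lam) ->
            {in string_lengths zs, forall p, d - 1 <= p \/ p <= 2}%N]].
Proof.
have homF : F \is d.-homog by apply: perazzo_homog perF; apply: leq_trans d_ge5.
have XYZF : XYZ_linear F.
  by case: (perF) => p0 [p1 [p2 [G [_ ->]]]]; apply: incUV_XYZ_linear.
(* The two Jordan types are obtained in the given coordinates, with the identity matrix as change of
   variables. *)
have [long short] := jordan_types_occur charK homF d_ge5 hilbF
  (comp1_phi F (unitmx1 K 5))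
  (phi_XYZ_mul (unitmx1 K 5) (lin_subst1 F) XYZF).
split=> // l hl nwl zs jzs; split=> [[M uM FE]|[M uM FE]|lam lam0 [M uM FE]].
(* From here on the generators are the images of the variables in which [F] has its normal form, and
   the differential relations of that form become relations in A_F. *)
- have NN := phi_XYZ_mul uM FE (@form_i_XYZ_linear _ d).
  have vvv := (phi_eq0 uM FE _).2 (form_i_VVV K d); rewrite !phiM in vvv.
  exact: (strings_triple charK homF d_ge5 hilbF (comp1_phi F uM) NN hl nwl jzs vvv).
- have NN := phi_XYZ_mul uM FE (@form_ii_XYZ_linear _ d).
  have [vx vvy uz uvv vy] := form_ii_relations d_ge5 charK.
  have [ux vz] := form_ii_nonzero d charK.
  have g0 : ((d - 1)%:R^-1 : K) != 0.
    by rewrite invr_eq0 ((pcharf0P K).1 charK) -lt0n subn_gt0 (leq_trans _ d_ge5).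
  move/(phi_eq0 uM FE): vx; rewrite phiM mulrC => vx.
  move/(phi_eq0 uM FE): vvy; rewrite !phiM mulrC mulrA => vvy.
  move/(phi_eq0 uM FE): uz; rewrite phiM mulrC => uz.
  move/(phi_eq0 uM FE): uvv; rewrite !phiM => uvv.
  move/(phi_eq uM FE): vy; rewrite phiZ !phiM mulrC [_ * apolar_coord_map _ _ (pX K)]mulrC => vy.
  have := phi_neq0 uM FE ux; rewrite phiM phiX => {}ux.
  have := phi_neq0 uM FE vz; rewrite phiM phiX => {}vz.
  exact: (strings_double charK homF d_ge5 hilbF (comp1_phi F uM) NN hl nwl jzs
    g0 vx vvy uz uvv vy ux vz).
- have NN := phi_XYZ_mul uM FE (@form_iii_XYZ_linear _ d lam).
  have [vx uz vy uvv] := form_iii_relations d lam.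
  have [ux uy vz] := form_iii_nonzero d lam charK.
  move/(phi_eq0 uM FE): vx; rewrite phiM mulrC => vx.
  move/(phi_eq0 uM FE): uz; rewrite phiM mulrC => uz.
  move/(phi_eq uM FE): vy; rewrite phiZ !phiM mulrC [_ * apolar_coord_map _ _ (pY K)]mulrC => vy.
  move/(phi_eq uM FE): uvv; rewrite phiZ !phiM [apolar_coord_map _ _ (pV K) * _]mulrC => uvv.
  have := phi_neq0 uM FE ux; rewrite phiM phiX => {}ux.
  have := phi_neq0 uM FE uy; rewrite phiM phiX => {}uy.
  have := phi_neq0 uM FE vz; rewrite phiM phiX => {}vz.
  exact: (strings_distinct charK homF d_ge5 hilbF (comp1_phi F uM) NN hl nwl jzs
    lam0 vx uz vy uvv ux uy vz).
Qed.
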